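(* Let $(M,g)$ be a compact connected pseudo-Kähler manifold with complex-structure tensor $J$, such that the complex manifold $M$ has the $\partial\overline{\partial}$ property, and let $v$ be an affine vector field on $(M,g)$. Then there exist a smooth function $\phi:M\to\mathbb{R}$ and a real $1$-form $\xi$ on $M$ such that the complex-valued $1$-form $\xi-i\,\xi J$ (whose real part is $\xi$) is holomorphic and $$g(v,\,\cdot\,)=(d\phi)J+\xi .$$
   Context: All manifolds and tensor fields are smooth; manifolds are connected. A pseudo-Kähler manifold is a pseudo-Riemannian manifold $(M,g)$ (the metric $g$ need not be definite) endowed with an almost-complex structure $J$ which is parallel for the Levi-Civita connection $\nabla$ of $g$ and makes $g$ Hermitian, i.e. $g(J\cdot,J\cdot)=g$. Then $J$ is integrable, so $M$ is a complex manifold. A compact complex manifold $M$ has the $\partial\overline{\partial}$ property if, for all integers $p,q\ge 0$, every closed complex-valued $(p,q)$-form on $M$ that is $\partial$-exact or $\overline{\partial}$-exact equals $\partial\overline{\partial}\lambda$ for some $(p-1,q-1)$-form $\lambda$ (in particular it is zero if $p=0$ or $q=0$). A vector field $v$ on $(M,g)$ is affine if its local flow preserves the Levi-Civita connection $\nabla$ of $g$ (equivalently $\mathcal{L}_v\nabla=0$, with $\mathcal{L}_v$ the Lie derivative). For a $1$-form $\eta$ on $M$, $\eta J$ denotes the $1$-form $w\mapsto\eta(Jw)$; thus $(d\phi)J$ is $w\mapsto d\phi(Jw)$. A holomorphic $1$-form is a $(1,0)$-form $\zeta$ with $\overline{\partial}\zeta=0$. *)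

(* Defs.v *)
From HB Require Import structures.
From mathcomp Require Import all_boot all_order all_algebra.
From mathcomp Require Import all_classical all_reals all_analysis.
Import Order.TTheory GRing.Theory Num.Theory.
Import numFieldNormedType.Exports.

Set Implicit Arguments.
Unset Strict Implicit.
Unset Printing Implicit Defensive.

Local Open Scope classical_set_scope.
Local Open Scope ring_scope.

(** * Smooth functions on open subsets of R^n *)

Section EuclideanSmoothness.
Context {R : realType} {n : nat}.
Implicit Types (U : set 'rV[R]_n) (f g : 'rV[R]_n -> R).

(* Class C^k on an open set [U]; the partial derivatives are the directional
   derivatives along the standard basis [delta_mx 0 i]. *)
Fixpoint Ck_on (k : nat) U f : Prop :=
  (forall x, U x -> {for x, continuous f}) /\
  (if k is k'.+1 then
     forall i : 'I_n, (forall x, U x -> derivable f x (delta_mx 0 i)) /\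
       Ck_on k' U (fun x => 'D_(delta_mx 0 i) f x)
   else True).

Definition smooth_on U f : Prop := forall k, Ck_on k U f.

Lemma open_eq_near U f g x : open U -> (forall y, U y -> f y = g y) -> U x ->
  \forall y \near x, f y = g y.
Proof. by move=> oU fg Ux; apply: filterS fg _; exact: open_nbhs_nbhs. Qed.

Lemma Ck_on_eq k U f g : open U -> (forall y, U y -> f y = g y) ->
  Ck_on k U f -> Ck_on k U g.
Proof.
move=> oU; elim: k f g => [|k IH] f g fg Hf;
    have cg x (Ux : U x) : {for x, continuous g}
      by (have := Hf.1 _ Ux; rewrite /prop_for /continuous_at (fg _ Ux);
          exact: cvg_trans (near_eq_cvg (open_eq_near oU fg Ux))).
  by split.
split=> // i; have [d c] := Hf.2 i; split=> [x Ux|].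
  apply: near_eq_derivable (d _ Ux); exact: open_eq_near fg Ux.
by apply: IH c => x Ux; apply: near_eq_derive; exact: open_eq_near fg Ux.
Qed.

Lemma Ck_on_cst k U (c : R) : Ck_on k U (cst c).
Proof.
elim: k c => [|k IH] c /=; first by split=> // x _; exact: cst_continuous.
split=> [x _|i]; first exact: cst_continuous.
split=> [x _|]; first exact: derivable_cst.
have -> : (fun x : 'rV[R]_n => 'D_(delta_mx 0 i) (cst c) x) = cst (0 : R).
  by rewrite funeqE => x; rewrite derive_cst.
exact: IH.
Qed.

Lemma Ck_on_S k U f : Ck_on k.+1 U f -> Ck_on k U f.
Proof.
elim: k f => [|k IH] f; first by case.
move=> [cf df]; split=> // i; have [d c] := df i; split=> //; exact: IH.
Qed.

Lemma Ck_on_add k U f g : open U ->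
  Ck_on k U f -> Ck_on k U g -> Ck_on k U (f + g).
Proof.
move=> oU; elim: k f g => [|k IH] f g /= [cf df] [cg dg].
  split=> // x Ux; exact: continuousD (cf _ Ux) (cg _ Ux).
split=> [x Ux|i]; first exact: continuousD (cf _ Ux) (cg _ Ux).
have [df1 df2] := df i; have [dg1 dg2] := dg i.
split=> [x Ux|]; first exact: derivableD (df1 _ Ux) (dg1 _ Ux).
apply: Ck_on_eq (IH _ _ df2 dg2) => // x Ux.
by rewrite (deriveD (df1 _ Ux) (dg1 _ Ux)).
Qed.

Lemma Ck_on_mul k U f g : open U ->
  Ck_on k U f -> Ck_on k U g -> Ck_on k U (f * g).
Proof.
move=> oU; elim: k f g => [|k IH] f g Hf Hg.
  by split=> // x Ux; exact: continuousM (Hf.1 _ Ux) (Hg.1 _ Ux).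
split=> [x Ux|i]; first exact: continuousM (Hf.1 _ Ux) (Hg.1 _ Ux).
have [df1 df2] := Hf.2 i; have [dg1 dg2] := Hg.2 i.
split=> [x Ux|]; first exact: derivableM (df1 _ Ux) (dg1 _ Ux).
apply: Ck_on_eq (Ck_on_add oU (IH _ _ (Ck_on_S Hf) dg2)
                           (IH _ _ (Ck_on_S Hg) df2)) => // x Ux.
by rewrite (deriveM (df1 _ Ux) (dg1 _ Ux)).
Qed.

End EuclideanSmoothness.

(** * Smooth manifolds and their smooth functions *)

(* [chart_inv] is total; only its values on [chart_map @` chart_dom] matter. *)
Record chart (R : realType) (T : topologicalType) (n : nat) := Chart {
  chart_dom : set T;
  chart_map : T -> 'rV[R]_n;
  chart_inv : 'rV[R]_n -> T;
  chart_dom_open : open chart_dom;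
  chart_img_open : open (chart_map @` chart_dom);
  chart_mapK : forall x, chart_dom x -> chart_inv (chart_map x) = x;
  chart_map_continuous :
    forall x, chart_dom x -> {for x, continuous chart_map};
  chart_inv_continuous :
    forall y, (chart_map @` chart_dom) y -> {for y, continuous chart_inv} }.

Arguments chart_dom_open {R T n} c.
Arguments chart_img_open {R T n} c.

Definition compatible_charts (R : realType) (T : topologicalType) (n : nat)
    (c d : chart R T n) : Prop :=
  forall i : 'I_n,
    smooth_on (chart_map c @` (chart_dom c `&` chart_dom d))
              (fun y => chart_map d (chart_inv c y) 0 i).

Record manifold (R : realType) := Manifold {
  carrier :> topologicalType;
  dim : nat;
  atlas : set (chart R carrier dim);
  manifold_hausdorff : hausdorff_space carrier;
  manifold_countable : @second_countable carrier;
  atlas_cover : forall x, exists2 c, atlas c & chart_dom c x;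
  atlas_compatible :
    forall c d, atlas c -> atlas d -> compatible_charts c d }.

Section SmoothFunctions.
Context {R : realType} (M : manifold R).

Definition smooth : {pred M -> R} := fun f =>
  `[< forall c, atlas c ->
        smooth_on (chart_map c @` chart_dom c) (f \o chart_inv c) >].

Lemma smooth_subring : subring_closed smooth.
Proof.
have sm1 (a : R) : (cst a : M -> R) \in smooth.
  by apply/asboolP => c _ k; exact: Ck_on_cst.
have smM : {in smooth &, forall f g, f * g \in smooth}.
  move=> f g /asboolP sf /asboolP sg; apply/asboolP => c ac k.
  by have := Ck_on_mul (chart_img_open c) (sf c ac k) (sg c ac k).
split=> // [|f g fs gs]; first exact: sm1.
have -> : f - g = f + cst (- 1) * g.
  by apply/funext => x; rewrite /= /GRing.add /= /GRing.mul /= mulN1r.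
have /asboolP s : cst (- 1) * g \in smooth by exact: smM.
move/asboolP: fs => fs; apply/asboolP => c ac k.
by have := Ck_on_add (chart_img_open c) (fs c ac k) (s c ac k).
Qed.

Lemma smooth_scale : GRing.scaler_closed smooth.
Proof.
move=> a f fs; have [_ _ smM] := smooth_subring.
have -> : a *: f = cst a * f by [].
by apply: smM => //; apply/asboolP => c _ k; exact: Ck_on_cst.
Qed.

HB.instance Definition _ :=
  GRing.isSubringClosed.Build (M -> R) smooth smooth_subring.
HB.instance Definition _ :=
  GRing.isScaleClosed.Build R (M -> R) smooth smooth_scale.

(* C^oo(M), an [R]-module and a commutative ring *)
Record smoothFun := SmoothFun {
  smooth_fun :> M -> R;
  smooth_funP : smooth_fun \in smooth }.

HB.instance Definition _ := [isSub for smooth_fun].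
HB.instance Definition _ := [Choice of smoothFun by <:].
HB.instance Definition _ := 
  GRing.SubChoice_isSubComPzRing.Build (M -> R) smooth smoothFun smooth_subring.
HB.instance Definition _ := [SubZmodule_isSubLmodule of smoothFun by <:].

End SmoothFunctions.

Notation "''C^oo' ( M )" := (smoothFun M) (format "''C^oo' ( M )").

(** * Vector fields *)

Section VectorFields.
Context {R : realType} (M : manifold R).

(* A vector field assigns to each point [p] a derivation [f |-> X f p] at [p],
   smoothly in [p]; this is the same as a derivation of the algebra C^oo(M).
   The codomain is written 'C^oo(M)^o to make the operators a C^oo(M)-module. *)
Definition derivation : {pred 'C^oo(M) -> 'C^oo(M)^o} := fun X =>
  `[< [/\ forall f g, X (f + g) = X f + X g,
          forall (c : R) f, X (c *: f) = c *: (X f : 'C^oo(M)) &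
          forall f g, X (f * g) = f * X g + g * X f] >].

Lemma derivation_submod : submod_closed derivation.
Proof.
split=> [|a X Y /asboolP[XD XZ XM] /asboolP[YD YZ YM]].
  apply/asboolP; split=> [f g|c f|f g].
  - by rewrite /GRing.zero /= addr0.
  - by rewrite /GRing.zero /= scaler0.
  - by rewrite /GRing.zero /= !mulr0 addr0.
have E f : (a *: X + Y) f = a * X f + Y f by [].
apply/asboolP; split=> [f g|c f|f g]; rewrite !E.
- by rewrite XD YD mulrDr addrACA.
- rewrite XZ YZ scalerDr; congr (_ + _); apply/val_inj/funext => x.
  by rewrite /= /GRing.mul /= /GRing.scale /= mulrCA.
- rewrite XM YM !mulrDr addrACA; congr (_ + _); congr (_ + _);
  by rewrite mulrCA.
Qed.

HB.instance Definition _ :=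
  GRing.isSubmodClosed.Build 'C^oo(M) ('C^oo(M) -> 'C^oo(M)^o) derivation
    derivation_submod.

Record vectorField := VectorField {
  vf_act :> 'C^oo(M) -> 'C^oo(M)^o;
  vf_derivation : vf_act \in derivation }.

HB.instance Definition _ := [isSub for vf_act].
HB.instance Definition _ := [Choice of vectorField by <:].
HB.instance Definition _ := [SubChoice_isSubLmodule of vectorField by <:].

Lemma lie_bracket_subproof (X Y : vectorField) :
  ((fun f => X (Y f) - Y (X f)) : 'C^oo(M) -> 'C^oo(M)^o) \in derivation.
Proof.
have /asboolP[XD XZ XM] := vf_derivation X.
have /asboolP[YD YZ YM] := vf_derivation Y.
apply/asboolP; split=> [f g|c f|f g].
- by rewrite YD !XD YD opprD addrACA.
- by rewrite YZ !XZ YZ scalerBr.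
- have aux (a a' b b' p q : 'C^oo(M)) :
    ((a + p) + (b + q)) - ((a' + q) + (b' + p)) = (a - a') + (b - b').
    rewrite (addrACA a) (addrACA a') (addrC q) opprD.
    by rewrite (addrACA (a + b)) subrr addr0 opprD (addrACA a).
  rewrite YM XM XD YD !XM !YM !mulrBr.
  rewrite [Y f * X g]mulrC [Y g * X f]mulrC; exact: aux.
Qed.

Definition lie_bracket (X Y : vectorField) : vectorField :=
  VectorField (lie_bracket_subproof X Y).

End VectorFields.

(** * Pseudo-Kaehler metrics and affine vector fields *)

(* Tensor fields are encoded as C^oo(M)-multilinear maps on the module of
   vector fields. *)

Section PseudoKaehler.
Context {R : realType} (M : manifold R).
Local Notation A := 'C^oo(M).
Local Notation V := (vectorField M).
Implicit Types (g : V -> V -> A) (J : {linear V -> V}) (nabla : V -> V -> V).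

(* Non-degeneracy is pointwise: [X f p = 0] for all [f] means [X] vanishes
   at [p]. No definiteness is required. *)
Record pseudo_riemannian g : Prop := {
  metric_sym : forall X Y : V, g X Y = g Y X;
  metric_linear : forall (X : V) (f : A) (Y Z : V), g X (f *: Y + Z) = f * g X Y + g X Z;
  metric_nondegenerate : forall (p : M) (X : V),
    (forall Y : V, g X Y p = 0) -> forall f : A, (X f : A) p = 0 }.

Record connection nabla : Prop := {
  connection_linear : forall (f : A) (X Y Z : V),
    nabla (f *: X + Y) Z = f *: nabla X Z + nabla Y Z;
  connection_add : forall X Y Z : V, nabla X (Y + Z) = nabla X Y + nabla X Z;
  connection_leibniz : forall (X : V) (f : A) (Y : V),
    nabla X (f *: Y) = (X f : A) *: Y + f *: nabla X Y }.

Record levi_civita g nabla : Prop := {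
  levi_civita_connection : connection nabla;
  levi_civita_torsion : forall X Y : V, nabla X Y - nabla Y X = lie_bracket X Y;
  levi_civita_metric : forall X Y Z : V,
    X (g Y Z) = g (nabla X Y) Z + g Y (nabla X Z) }.

Record pseudo_kaehler g J nabla : Prop := {
  pseudo_kaehler_metric : pseudo_riemannian g;
  pseudo_kaehler_levi_civita : levi_civita g nabla;
  pseudo_kaehler_complex : forall X : V, J (J X) = - X;
  pseudo_kaehler_hermitian : forall X Y : V, g (J X) (J Y) = g X Y;
  pseudo_kaehler_parallel : forall X Y : V, nabla X (J Y) = J (nabla X Y) }.

(* (L_v nabla)(X, Y) = 0 *)
Definition affine nabla (v : V) : Prop := forall X Y : V,
  lie_bracket v (nabla X Y) - nabla (lie_bracket v X) Y
    - nabla X (lie_bracket v Y) = 0.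

End PseudoKaehler.

(** * Complex-valued differential forms *)

Section ComplexForms.
Context {R : realType} (M : manifold R).
Local Notation A := 'C^oo(M).
Local Notation V := (vectorField M).

(* The pair [(a, b)] stands for the complex-valued function a + i b. *)
Definition smoothFunC : Type := (A^o * A^o)%type.
HB.instance Definition _ := GRing.Lmodule.on smoothFunC.

Definition mul_i (u : smoothFunC) : smoothFunC := (- u.2, u.1).

Definition vf_actC (X : V) (u : smoothFunC) : smoothFunC := (X u.1, X u.2).

Definition cform (k : nat) : Type := ('I_k -> V) -> smoothFunC.

Definition set_arg (k : nat) (X : 'I_k -> V) (i : 'I_k) (Y : V) : 'I_k -> V :=
  fun j => if j == i then Y else X j.

Record is_form (k : nat) (alpha : cform k) : Prop := {
  form_multilinear : forall (X : 'I_k -> V) i (f : A) Y Z,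
    alpha (set_arg X i (f *: Y + Z)) =
    f *: alpha (set_arg X i Y) + alpha (set_arg X i Z);
  form_alternating : forall (X : 'I_k -> V) i j,
    i != j -> X i = X j -> alpha X = 0 }.

(* The exterior derivative
     d alpha (X_0, .., X_k)
       = \sum_i (-1)^i X_i (alpha (.., ^X_i, ..))
         + \sum_(i < j) (-1)^(i+j) alpha ([X_i, X_j], .., ^X_i, .., ^X_j, ..).
   In the second sum the bracket is moved from the front to the slot of [X_j],
   of index [j - 1] once [X_i] is omitted, which turns the sign (-1)^(i+j) into
   - (-1)^i; here [j = lift i l] with [i <= l]. *)
Definition dform (k : nat) (alpha : cform k) : cform k.+1 := fun X =>
  \sum_(i < k.+1) (-1 : A) ^+ i *:
    (vf_actC (X i) (alpha (X \o lift i))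
     - \sum_(l < k | (i <= l)%N)
         alpha (set_arg (X \o lift i) l
                        (lie_bracket (X i) (X (lift i l))))).

(* The complex-multilinear extension of [alpha] to complex vector fields;
   [Z j] stands for (Z j).1 + i (Z j).2, and [T] is the set of arguments of
   which the imaginary part is taken. *)
Definition cextend (k : nat) (alpha : cform k) (Z : 'I_k -> V * V) :
    smoothFunC :=
  \sum_(T : {set 'I_k}) iter #|T| mul_i
    (alpha (fun j => if j \in T then (Z j).2 else (Z j).1)).

Section Dolbeault.
Variable J : {linear V -> V}.

Definition half : A := (2^-1 : R) *: (1 : A).

(* (1,0) and (0,1) parts (X - i J X)/2 and (X + i J X)/2 of a real field *)
Definition part10 (X : V) : V * V := (half *: X, - (half *: J X)).
Definition part01 (X : V) : V * V := (half *: X, half *: J X).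

(* [alpha] with the arguments in [S] replaced by their (1,0) parts and the
   others by their (0,1) parts *)
Definition type_part (k : nat) (S : {set 'I_k}) (alpha : cform k) : cform k :=
  fun X => cextend alpha
    (fun j => if j \in S then part10 (X j) else part01 (X j)).

(* [alpha] is a (p,q)-form: it vanishes on k-tuples of fields of type (1,0) or
   (0,1) unless exactly p of them are of type (1,0). Every (1,0) field, that is
   every X + i Y with Y = - J X, is [part10] of a real field. *)
Definition bidegree (p q : nat) (k : nat) (alpha : cform k) : Prop :=
  [/\ k = (p + q)%N, is_form alpha &
      forall S : {set 'I_k}, #|S| != p -> type_part S alpha = 0].

(* The (p, k - p) component of a k-form *)
Definition component (p k : nat) (alpha : cform k) : cform k :=
  \sum_(S : {set 'I_k} | #|S| == p) type_part S alpha.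

(* On (p,q)-forms, [del p] and [delbar p] are the (p+1,q) and (p,q+1)
   components of d. *)
Definition del (p k : nat) (alpha : cform k) : cform k.+1 :=
  component p.+1 (dform alpha).
Definition delbar (p k : nat) (alpha : cform k) : cform k.+1 :=
  component p (dform alpha).

(* A (p,q)-form with p < 0 or q < 0 is zero, whence the first constructors. *)
Inductive del_exact : forall p q k : nat, cform k -> Prop :=
| del_exact0 p q k : @del_exact p q k 0
| del_exactS p q k (beta : cform k) :
    bidegree p q beta -> del_exact p.+1 q (del p beta).

Inductive delbar_exact : forall p q k : nat, cform k -> Prop :=
| delbar_exact0 p q k : @delbar_exact p q k 0
| delbar_exactS p q k (beta : cform k) :
    bidegree p q beta -> delbar_exact p q.+1 (delbar p beta).

Inductive deldelbar_exact : forall p q k : nat, cform k -> Prop :=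
| deldelbar_exact0 p q k : @deldelbar_exact p q k 0
| deldelbar_exactS p q k (lambda : cform k) :
    bidegree p q lambda ->
    deldelbar_exact p.+1 q.+1 (del p (delbar p lambda)).

Definition deldelbar_property : Prop :=
  forall (p q k : nat) (alpha : cform k),
    bidegree p q alpha -> dform alpha = 0 ->
    del_exact p q alpha \/ delbar_exact p q alpha ->
    deldelbar_exact p q alpha.

Definition holomorphic_1form (zeta : cform 1) : Prop :=
  bidegree 1 0 zeta /\ delbar 1 zeta = 0.

(* xi - i xi J *)
Definition form10_of (xi : V -> A) : cform 1 :=
  fun X => (xi (X ord0), - xi (J (X ord0))).

End Dolbeault.
End ComplexForms.

(* Main.v *)
(* Put omega = g(., J .) and let al = omega(v, .) = g(v, J .), so that
   beta := d al is the Lie derivative of omega along v; as v is affine, beta is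
   parallel.  Hence its (2,0) part is parallel, thus closed, and
   it is del of the (1,0) part of al: the del-delbar property makes it zero.  So
   beta and d g(v, .) are J-invariant, and delbar of al - i al J is
   beta + i d g(v, .), a closed delbar-exact (1,1)-form, hence equal to
   del delbar (a + i b).  Taking real parts, beta is a multiple of d(db J).

   The symmetric form h = beta(., J .) is then parallel, and h <= 0 at a maximum
   of b while h >= 0 at a minimum.  Semidefiniteness of a parallel form spreads
   along curves, so h = 0 by connectedness, and beta = 0.  With phi = a / 2 and
   xi = g(v, .) - d phi J both xi and xi J have exterior derivatives without
   (1,1) part, which is the holomorphy of xi - i xi J.

   Derivations of C^oo(M) are reached through Hadamard's lemma: if psi is a bump
   function supported in a chart, psi^3 X is a combination of the fields
   psi d/dx_i for every derivation X. *)
Require Import Defs.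
From HB Require Import structures.
From mathcomp Require Import all_boot all_order all_algebra.
From mathcomp Require Import all_classical all_reals all_analysis.
From mathcomp Require Import ring lra.
Import Order.TTheory GRing.Theory Num.Theory.
Import numFieldNormedType.Exports.
Set Implicit Arguments.
Unset Strict Implicit.
Unset Printing Implicit Defensive.
Local Open Scope classical_set_scope.
Local Open Scope ring_scope.

(** Since g may be indefinite, integral identities for g carry no sign, and a parallel tensor cannot
    be controlled by its norm. This is why [beta] is killed by a maximum principle: compactness only
    supplies the sign of h at two points, and these signs must then be carried over M. No parallel
    transport is built for this. In a frame along a chart segment the matrix of h solves H' = G H +
    H G^T, and such an equation preserves semidefiniteness, as a minimum of a weighted quadratic
    form shows.

    A single form handles d al and d g(v, .) together: eta = al - i al J satisfies d eta = d al + i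
    d g(v, .), while the conjugate of eta has type (0,1), so its derivative has no (2,0) part. Hence
    the (2,0) part of d eta is twice that of d al, and it inherits parallelism from d al alone.

    As vector fields act on global functions only, local fields are cut off by a bump function psi.
    The resulting powers of psi are divided out where psi > 0. *)

Local Notation unit_segment R := (`[0%R, 1%R]%classic : set R).

(** * Functions of class C^k of several variables *)

Section PartialDerivatives.
Context {R : realType} {n : nat}.
Implicit Types (U V : set 'rV[R]_n) (f : 'rV[R]_n -> R).

Lemma Ck_on_sub k U V f : U `<=` V -> Ck_on k V f -> Ck_on k U f.
Proof.
move=> UV; elim: k f => [|k IH] f [cf df]; first by split=> // x /UV; exact: cf.
split=> [x /UV|i]; first exact: cf.
have [d c] := df i; split=> [x /UV|]; first exact: d.
exact: IH.
Qed.

Lemma Ck_on_local k U f :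
  (forall x, U x -> exists2 V, V x & Ck_on k V f) -> Ck_on k U f.
Proof.
elim: k f => [|k IH] f H; split=> //.
- by move=> x /H[V Vx [cf _]]; exact: cf.
- by move=> x /H[V Vx [cf _]]; exact: cf.
move=> i; split=> [x /H[V Vx [_ df]]|]; first exact: (df i).1.
by apply: IH => x /H[V Vx [_ df]]; exists V => //; exact: (df i).2.
Qed.

Lemma Ck_on_sum k U m (F : 'I_m -> 'rV[R]_n -> R) : open U ->
  (forall i, Ck_on k U (F i)) -> Ck_on k U (\sum_i F i).
Proof.
move=> oU HF; elim/big_ind: _ => //; first exact: (Ck_on_cst k U 0).
by move=> f g; exact: Ck_on_add.
Qed.

Lemma is_derive_coord (x v : 'rV[R]_n) i :
  is_derive x v (fun y : 'rV[R]_n => y 0 i) (v 0 i).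
Proof.
have /derivable_mxP/(_ 0 i) d := @derivable_id R 'rV[R]_n x v.
apply: DeriveDef => //.
have := derive_id x v; rewrite derive_mx; last exact: derivable_id.
by move/matrixP/(_ 0 i); rewrite mxE.
Qed.

Lemma Ck_on_coord k U i : Ck_on k U (fun x => x 0 i).
Proof.
have cc : continuous (fun x : 'rV[R]_n => x 0 i) by exact: coord_continuous.
case: k => [|k]; first by split=> // x _; exact: cc.
split=> [x _|j]; first exact: cc.
split=> [x _|]; first by case: (is_derive_coord x (delta_mx 0 j) i).
have -> : (fun x : 'rV[R]_n => 'D_(delta_mx 0 j) (fun y : 'rV[R]_n => y 0 i) x) =
    cst ((delta_mx 0 j : 'rV[R]_n) 0 i).
  by apply/funext => x; case: (is_derive_coord x (delta_mx 0 j) i).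
exact: Ck_on_cst.
Qed.

Lemma is_derive_line f (z v : 'rV[R]_n) (s : R) : derivable f (z + s *: v) v ->
  is_derive s 1 (fun t => f (z + t *: v)) ('D_v f (z + s *: v)).
Proof.
have E : (fun h : R => h^-1 *: (f (h *: v + (z + s *: v)) - f (z + s *: v))) =
  (fun h : R => h^-1 *: (((fun t => f (z + t *: v)) \o shift s) (h *: (1 : R)) -
     f (z + s *: v))).
  apply/funext => h /=; rewrite [h *: 1]mulr1 scalerDl.
  by rewrite addrCA [h *: v + _]addrC.
move=> df; apply: DeriveDef; rewrite /derivable /derive.
- by rewrite -E.
- by rewrite -E.
Qed.

Lemma partial_mean_value f (z v : 'rV[R]_n) (a : R) :
  (forall s : R, `|s| <= `|a| -> derivable f (z + s *: v) v) ->
  exists2 c : R, `|c| <= `|a| & f (z + a *: v) - f z = a * 'D_v f (z + c *: v).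
Proof.
move=> df.
have dg (s : R) : `|s| <= `|a| ->
    is_derive s 1 (fun t => f (z + t *: v)) ('D_v f (z + s *: v)).
  by move=> sa; exact: is_derive_line (df _ sa).
have z0 : z = z + 0 *: v by rewrite scale0r addr0.
have [a0|a0] := leP 0 a.
  have aE (s : R) : s \in `[0, a]%R -> `|s| <= `|a|.
    by rewrite in_itv /= => /andP[s0 sa]; rewrite !ger0_norm.
  have [||c ca E] := MVT_segment a0 (f := fun t => f (z + t *: v))
      (df := fun s => 'D_v f (z + s *: v)).
  - by move=> x xa; apply/dg/aE; exact: subset_itv_oo_cc xa.
  - apply: derivable_within_continuous => x xa; have := dg _ (aE _ xa).
    by case.
  exists c; first exact: aE.
  by rewrite {2}z0 E subr0 mulrC.
have aE (s : R) : s \in `[a, 0]%R -> `|s| <= `|a|.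
  rewrite in_itv /= => /andP[s0 sa].
  by rewrite !ler0_norm ?lerN2 // ltW.
have [||c ca E] := MVT_segment (ltW a0) (f := fun t => f (z + t *: v))
    (df := fun s => 'D_v f (z + s *: v)).
- by move=> x xa; apply/dg/aE; exact: subset_itv_oo_cc xa.
- apply: derivable_within_continuous => x xa; have := dg _ (aE _ xa).
  by case.
exists c; first exact: aE.
by apply: oppr_inj; rewrite opprB {1}z0 E sub0r mulrN mulrC.
Qed.

(** This is the case of zero differential, to which [C1_differentiable] reduces by subtracting a
    linear function. *)
Lemma differentiable_littleo f (x : 'rV[R]_n) :
  (forall e : R, 0 < e -> \forall h \near (0 : 'rV[R]_n),
     `|f (h + x) - f x| <= e * `|h|) -> differentiable f x.
Proof.
move=> H.
pose f' : 'rV[R]_n -> R^o := f.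
have E : f' \o shift x = cst (f' x) + (\0 : 'rV[R]_n -> R^o) +o_ (0 : 'rV[R]_n) id.
  apply/eqaddoP => e e0; apply: filterS (H e e0) => h /=.
  move=> H1; apply: le_trans H1; rewrite le_eqVlt; apply/orP; left.
  apply/eqP; congr (`|_|).
  by change (f (h + x) - (f x + 0) = f (h + x) - f x); rewrite addr0.
have D := diff_unique (df := (\0 : {linear 'rV[R]_n -> R^o})) (@cst_continuous _ _ 0) E.
apply/diff_locallyP; rewrite D; split=> //.
exact: cst_continuous.
Qed.

End PartialDerivatives.

Lemma continuous_sum_at (R : realType) (T : topologicalType) (I : Type) (r : seq I)
    (F : I -> T -> R) (x : T) :
  (forall i, {for x, continuous (F i)}) ->
  {for x, continuous (fun y => \sum_(i <- r) F i y)}.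
Proof.
move=> cF; elim: r => [|i r IHr].
  rewrite (_ : (fun _ => _) = cst 0); first exact: cst_continuous.
  by apply/funext => s; rewrite big_nil.
rewrite (_ : (fun _ => _) = (fun y => F i y + \sum_(j <- r) F j y)).
  by apply: continuousD => //; exact: cF.
by apply/funext => s; rewrite big_cons.
Qed.

Section MatrixNorm.
Context {R : realType} {n : nat}.
Implicit Types x : 'rV[R]_n.

Lemma rV_norm_coord x i : `|x 0 i| <= `|x|.
Proof.
rewrite [leRHS]/Num.Def.normr/= mx_normrE.
exact: (le_bigmax _ (fun ij : 'I_1 * 'I_n => `|x ij.1 ij.2|) (0, i)).
Qed.

Lemma rV_norm_le x (e : R) : 0 <= e -> (forall i, `|x 0 i| <= e) -> `|x| <= e.
Proof.
move=> e0 H; rewrite [leLHS]/Num.Def.normr/= mx_normrE.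
apply: bigmax_le => // -[i j] _ /=; rewrite ord1; exact: H.
Qed.

End MatrixNorm.

(** * Differentiability of C^1 functions and the chain rule *)

Section ChainRule.
Context {R : realType}.

Lemma Ck_on_continuous n k (U : set 'rV[R]_n) f x :
  Ck_on k U f -> U x -> {for x, continuous f}.
Proof. by case: k => [|k] [cf _] Ux; exact: cf. Qed.

Lemma Ck_on_leq n j k (U : set 'rV[R]_n) f :
  (j <= k)%N -> Ck_on k U f -> Ck_on j U f.
Proof.
move=> /subnK <-; elim: (k - j)%N => // i IH Hf; apply: IH; exact: Ck_on_S.
Qed.

(** After the linear part built from the partials at [x] is subtracted, the increment is split along
    a staircase from [x] to [x + h] that moves one coordinate at a time. The mean value theorem on
    each edge compares a partial at a nearby point with its value at [x]. *)
Lemma C1_differentiable n (U : set 'rV[R]_n) (f : 'rV[R]_n -> R) x :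
  open U -> U x -> Ck_on 1 U f -> differentiable f x.
Proof.
move=> oU Ux [cf df].
pose a j := 'D_(delta_mx 0 j) f x.
pose L : 'I_n -> 'rV[R]_n -> R := fun j y => y 0 j * a j.
have dL j : differentiable (L j) x.
  apply: differentiableM => //; exact: differentiable_coord.
suff dr : differentiable (f - \sum_j L j) x.
  rewrite -(subrK (\sum_j L j) f); apply: differentiableD => //.
  exact: differentiable_sum.
apply: differentiable_littleo => e e0.
have n1 : 0 < (n.+1%:R : R) by rewrite ltr0n.
(* Each of the [n] edges may cost this share of [e]; the successor keeps the denominator nonzero
   when [n] is 0. *)
have e'0 : 0 < e / n.+1%:R by rewrite divr_gt0.
have near_x : \forall y \near x, U y /\
    forall j, `|a j - 'D_(delta_mx 0 j) f y| < e / n.+1%:R.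
  near=> y; split.
    by near: y; exact: open_nbhs_nbhs.
  near: y; apply: filter_forall => j.
  have [_ [cd _]] := df j.
  by have /cvgrPdist_lt := cd _ Ux; apply.
have /nbhs_ballP[d /= d0 dH] := near_x.
apply/nbhs_ballP; exists d => //= h; rewrite -ball_normE /= sub0r normrN => hd.
pose hk (k : nat) : 'rV[R]_n := \row_j (if (j < k)%N then h 0 j else 0).
have hk_le k (i : 'I_n) s : i = k :> nat -> `|s| <= `|h 0 i| ->
    `|hk k + s *: delta_mx 0 i| <= `|h|.
  move=> ik sh; apply: rV_norm_le => // j; rewrite !mxE eqxx /= -ik.
  have [->|ji] := eqVneq j i.
    by rewrite ltnn add0r mulr1 (le_trans sh) // rV_norm_coord.
  rewrite mulr0 addr0; case: ifP => // _; rewrite ?normr0 //.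
  exact: rV_norm_coord.
have in_ball k (i : 'I_n) s : i = k :> nat -> `|s| <= `|h 0 i| ->
    ball x d (x + hk k + s *: delta_mx 0 i).
  move=> ik sh; rewrite -ball_normE /= -addrA opprD addrA subrr sub0r normrN.
  by rewrite (le_lt_trans (hk_le _ _ _ ik sh)).
have hkS (i : 'I_n) : hk i.+1 = hk i + h 0 i *: delta_mx 0 i.
  apply/rowP => j; rewrite !mxE eqxx /= ltnS leq_eqVlt.
  have [->|ji] := eqVneq j i; first by rewrite eqxx ltnn add0r mulr1.
  by rewrite -val_eqE in ji; rewrite (negbTE ji) mulr0 addr0.
have step (i : 'I_n) :
    `|f (x + hk i.+1) - f (x + hk i) - h 0 i * a i| <= e / n.+1%:R * `|h|.
  have [s sh|c ch E] := @partial_mean_value R n f (x + hk i) (delta_mx 0 i) (h 0 i).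
    by apply: (df i).1; have [] := dH _ (in_ball _ _ _ erefl sh).
  rewrite hkS addrA E -mulrBr normrM mulrC.
  apply: ler_pM => //; last exact: rV_norm_coord.
  by rewrite distrC; have [_ /(_ i)/ltW] := dH _ (in_ball _ _ _ erefl ch).
have hk0 : hk 0%N = 0 by apply/rowP => j; rewrite !mxE ltn0.
have hkn : hk n = h by apply/rowP => j; rewrite !mxE ltn_ord.
have E : (f - \sum_j L j) (h + x) - (f - \sum_j L j) x =
    \sum_(i < n) (f (x + hk i.+1) - f (x + hk i) - h 0 i * a i).
  rewrite sumrB -(big_mkord xpredT (fun i => f (x + hk i.+1) - f (x + hk i))).
  rewrite telescope_sumr // hk0 hkn addr0 addrC.
  have EL y : (f - \sum_j L j) y = f y - \sum_j L j y.
    by rewrite /GRing.add /GRing.opp /= fct_sumE.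
  rewrite !EL [h + x]addrC /L.
  have -> : \sum_j (x + h) 0 j * a j = \sum_j x 0 j * a j + \sum_j h 0 j * a j.
    by rewrite -big_split; apply: eq_bigr => j _; rewrite mxE mulrDl.
  by ring.
rewrite E (le_trans (ler_norm_sum _ _ _)) //.
apply: (@le_trans _ _ (\sum_(i < n) e / n.+1%:R * `|h|)).
  by apply: ler_sum => i _; exact: step.
rewrite sumr_const card_ord -mulrnAl; apply: ler_wpM2r => //.
rewrite -mulrnAr -[leRHS]mulr1; apply: ler_wpM2l; first exact: ltW.
by rewrite -[_ *+ n]mulr_natl ler_pdivrMr // mul1r ler_nat.
Unshelve. all: by end_near. Qed.

Lemma derive_sum_partials n (f : 'rV[R]_n -> R) (x v : 'rV[R]_n) :
  differentiable f x ->
  'D_v f x = \sum_j v 0 j * 'D_(delta_mx 0 j) f x.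
Proof.
move=> df; rewrite deriveE // {1}(row_sum_delta v) linear_sum.
by apply: eq_bigr => j _; rewrite linearZ /= deriveE.
Qed.

Lemma differentiable_rV m n (phi : 'rV[R]_m -> 'rV[R]_n) x :
  (forall j, differentiable (fun y => phi y 0 j) x) -> differentiable phi x.
Proof.
move=> H; have -> : phi = \sum_j (fun y => phi y 0 j *: (delta_mx 0 j : 'rV[R]_n)).
  by apply/funext => y; rewrite fct_sumE {1}(row_sum_delta (phi y)).
by apply: differentiable_sum => j; exact: differentiableZl.
Qed.

Lemma is_derive_comp_rV m n (f : 'rV[R]_n -> R) (phi : 'rV[R]_m -> 'rV[R]_n) x v :
  (forall j, differentiable (fun y => phi y 0 j) x) ->
  differentiable f (phi x) ->
  is_derive x v (f \o phi)
    (\sum_j 'D_(delta_mx 0 j) f (phi x) * 'D_v (fun y => phi y 0 j) x).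
Proof.
move=> dphi df; have dp := differentiable_rV dphi.
have dc : differentiable (f \o phi) x by exact: differentiable_comp.
apply: DeriveDef; first exact: diff_derivable.
rewrite deriveE // diff_comp //= -deriveE // -deriveE //.
rewrite derive_sum_partials //; apply: eq_bigr => j _; rewrite mulrC.
by rewrite derive_mx ?mxE //; exact: diff_derivable.
Qed.

(** The inner map is smooth to all orders while [f] is only C^k, so the induction can be applied to
    the partials of [f] with the same [phi]. *)
Lemma Ck_on_comp k m n (U : set 'rV[R]_m) (V : set 'rV[R]_n)
    (f : 'rV[R]_n -> R) (phi : 'rV[R]_m -> 'rV[R]_n) :
  open U -> open V -> (forall x, U x -> V (phi x)) ->
  (forall j, smooth_on U (fun y => phi y 0 j)) ->
  Ck_on k V f -> Ck_on k U (f \o phi).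
Proof.
move=> oU oV UV sphi.
have dphi x : U x -> forall j, differentiable (fun y => phi y 0 j) x.
  by move=> Ux j; exact: (C1_differentiable oU Ux (sphi j 1%N)).
elim: k f => [|k IH] f Hf.
  split=> // x Ux; apply: continuous_comp; last exact: Hf.1 (UV _ Ux).
  exact: differentiable_continuous (differentiable_rV (dphi _ Ux)).
have ck : forall x, U x -> {for x, continuous (f \o phi)}.
  by move=> x Ux; exact: Ck_on_continuous (IH _ (Ck_on_S Hf)) Ux.
split=> // i.
have df y : V y -> differentiable f y.
  move=> Vy; apply: (C1_differentiable oV Vy).
  exact: Ck_on_leq Hf.
have D x : U x -> is_derive x (delta_mx 0 i) (f \o phi)
    (\sum_j 'D_(delta_mx 0 j) f (phi x) * 'D_(delta_mx 0 i) (fun y => phi y 0 j) x).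
  by move=> Ux; apply: is_derive_comp_rV; [exact: dphi|exact/df/UV].
split=> [x Ux|]; first by case: (D _ Ux).
apply: (@Ck_on_eq _ _ _ _ (\sum_j ((fun x => 'D_(delta_mx 0 j) f x) \o phi) *
    (fun x => 'D_(delta_mx 0 i) (fun y => phi y 0 j) x))) => //.
  move=> x Ux; case: (D _ Ux) => _ ->; rewrite fct_sumE.
  by apply: eq_bigr.
apply: Ck_on_sum => // j; apply: Ck_on_mul => //; first by apply: IH; exact: (Hf.2 j).2.
exact: ((sphi j k.+1).2 i).2.
Qed.

End ChainRule.

(** * Bump functions *)

Section Bump.
Context {R : realType}.

(* t^-m exp(-1/t) for t > 0; closed under differentiation up to linear
   combinations, which gives smoothness by induction. *)
Definition flat (m : nat) (t : R) : R :=
  if 0 < t then t^-1 ^+ m * expR (- t^-1) else 0.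

(** With u = 1/t this is u^(m+1) / (m+1)! <= exp u, one term of the exponential series. *)
Lemma flat_bound m (t : R) : `|flat m t| <= m.+1`!%:R * `|t|.
Proof.
rewrite /flat; case: ifP => [t0|_]; last by rewrite normr0 mulr_ge0.
have i0 : 0 < t^-1 by rewrite invr_gt0.
rewrite ger0_norm; last by rewrite mulr_ge0 ?expR_ge0 // exprn_ge0 // ltW.
rewrite expRN ler_pdivrMr ?expR_gt0 // ger0_norm ?(ltW t0) // -ler_pdivrMl; last first.
  by rewrite mulr_gt0 // ltr0n fact_gt0.
apply: le_trans (_ : t^-1 ^+ m.+1 / m.+1`!%:R <= _).
  by rewrite exprSr invfM mulrC mulrCA -mulrA mulrC mulrA.
by rewrite (le_trans _ (expR_ge1Dxn m (ltW i0))) // lerDr.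
Qed.

(** Only t = 0 is delicate: there the difference quotient of [flat m] is [flat m.+1], which
    [flat_bound] sends to 0. *)
Lemma is_derive_flat m (t : R) :
  is_derive t 1 (flat m) (flat m.+2 t - m%:R * flat m.+1 t).
Proof.
have [t0|t0|->] := ltgtP t 0.
- have E : flat m.+2 t - m%:R * flat m.+1 t = 0.
    by rewrite /flat ltNge (ltW t0) mulr0 subrr.
  rewrite E; apply: near_eq_is_derive (is_derive_cst (0 : R) t 1).
  near=> s; rewrite /flat /cst ltNge ltW //=; near: s; exact: lt_nbhsl.
- have tn0 : t != 0 by rewrite gt_eqF.
  have di : is_derive t 1 (fun s : R => s^-1) (- t^-1 ^+ 2).
    have := is_deriveV tn0 (is_derive_id t 1).
    by move=> /is_derive_eq; apply; rewrite [_ *: 1]mulr1 exprVn.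
  have dX := is_deriveX m di.
  have dN := is_deriveN di.
  have de := @is_derive1_comp R expR (- (fun s : R => s^-1)) t _ _
    (is_derive_expR (- t^-1)) dN.
  have dM := is_deriveM dX de.
  apply: (@near_eq_is_derive _ _ _
    ((fun s : R => s^-1) ^+ m * (expR \o (- (fun s : R => s^-1))))).
    near=> s; rewrite /flat ifT; last by near: s; exact: lt_nbhsr.
    by rewrite /GRing.mul /= /GRing.opp /=; congr (_ * _); rewrite exprfctE.
  apply: is_derive_eq dM _; rewrite /flat t0 /= exprfctE /=.
  rewrite /GRing.scale /= {1}/GRing.opp /=.
  case: m {dX} => [|m] /=; rewrite ?mul0r ?mulr0 ?expr0 ?exprS; ring.
- have E : flat m.+2 0 - m%:R * flat m.+1 0 = 0.
    by rewrite /flat ltxx mulr0 subrr.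
  suff H : h^-1 *: ((flat m \o shift 0) (h *: 1) - flat m 0) @[h --> 0^'] --> (0 : R).
    rewrite E; apply: DeriveDef; first by apply/cvg_ex; exists 0.
    exact: cvg_lim H.
  have H1 (h : R) : h != 0 ->
      h^-1 *: ((flat m \o shift 0) (h *: 1) - flat m 0) = flat m.+1 h.
    move=> h0; rewrite /= addr0 [h *: 1]mulr1 /flat ltxx subr0.
    by case: ifP => h0'; rewrite /GRing.scale /= ?mulr0 // exprS mulrA.
  apply/cvgrPdist_le => /= e e0; near=> h.
  rewrite sub0r normrN H1; last by near: h; exact: nbhs_dnbhs_neq.
  apply: le_trans (flat_bound _ _) _.
  rewrite -ler_pdivlMl ?ltr0n ?fact_gt0 //.
  near: h; apply: dnbhs0_le; rewrite mulr_gt0 // invr_gt0 ltr0n fact_gt0 //.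
Unshelve. all: by end_near. Qed.

Lemma flat_gt0 m t : (0 < flat m t) = (0 < t).
Proof.
rewrite /flat; case: ifP => // t0.
by rewrite mulr_gt0 ?expR_gt0 // exprn_gt0 // invr_gt0.
Qed.

Lemma flat_ge0 m t : 0 <= flat m t.
Proof.
rewrite /flat; case: ifP => // t0.
by rewrite mulr_ge0 ?expR_ge0 // exprn_ge0 // invr_ge0 ltW.
Qed.

Lemma Ck_on_flat n k m (U : set 'rV[R]_n) (s : 'rV[R]_n -> R) : open U ->
  smooth_on U s -> Ck_on k U (flat m \o s).
Proof.
move=> oU sm.
have dflat i t : differentiable (flat i) t.
  by apply/derivable1_diffP; case: (is_derive_flat i t).
have ds x : U x -> differentiable s x.
  by move=> Ux; exact: C1_differentiable oU Ux (sm 1%N).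
have D i x v : U x -> is_derive x v (flat i \o s)
    ((flat i.+2 (s x) - i%:R * flat i.+1 (s x)) * 'D_v s x).
  move=> Ux; have dc : differentiable (flat i \o s) x.
    by apply: differentiable_comp => //; exact: ds.
  apply: DeriveDef; first exact: diff_derivable.
  rewrite deriveE // diff_comp //=; last exact: ds.
  rewrite diff1E //= -deriveE; last exact: ds.
  by rewrite derive1E; case: (is_derive_flat i (s x)) => _ ->; rewrite [LHS]mulrC.
elim: k m => [|k IH] m.
  split=> // x Ux; apply: differentiable_continuous.
  by apply: differentiable_comp => //; exact: ds.
split=> [x Ux|i].
  apply: differentiable_continuous.
  by apply: differentiable_comp => //; exact: ds.
split=> [x Ux|]; first by case: (D m _ (delta_mx 0 i) Ux).
apply: (@Ck_on_eq _ _ _ _ ((flat m.+2 \o s + cst (- m%:R) * (flat m.+1 \o s)) *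
    (fun x => 'D_(delta_mx 0 i) s x))) => //.
  move=> x Ux; case: (D m _ (delta_mx 0 i) Ux) => _ ->.
  by rewrite /GRing.mul /= /GRing.add /= mulNr.
apply: Ck_on_mul => //; last exact: ((sm k.+1).2 i).2.
apply: Ck_on_add => //; apply: Ck_on_mul => //; exact: Ck_on_cst.
Qed.

End Bump.

(** * Hadamard's lemma *)

Section ParameterIntegral.
Context {R : realType}.
Local Notation mu := (@lebesgue_measure R).
Local Notation I01 := (unit_segment R).

(** A tube argument: the neighbourhoods given by joint continuity at the points (t, x) are made
    uniform in t by compactness of [0, 1]. *)
Lemma near_uniform_segment (T : topologicalType) (Phi : R -> T -> R) (x : T) :
  (forall t, I01 t -> {for (t, x), continuous (fun p : R * T => Phi p.1 p.2)}) ->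
  forall e : R, 0 < e ->
  \forall y \near x, forall t, I01 t -> `|Phi t x - Phi t y| <= e.
Proof.
move=> cPhi e e0.
have [] := @compact_near_coveringP _ I01 => /(_ (@segment_compact _ 0 1)) NC _.
apply: (NC _ _ (fun y t => `|Phi t x - Phi t y| <= e)) => t It.
have e20 : 0 < e / 2 by rewrite divr_gt0.
have /cvgrPdist_le/(_ _ e20) H := cPhi _ It.
have [[A B] [/= At Bx] AB] := H.
exists (A, B) => //= -[s y] /= [As By].
have xB : B x by exact: nbhs_singleton.
have h1 := AB (s, x) (conj As xB).
have h2 := AB (s, y) (conj As By).
rewrite /= in h1 h2.
rewrite (_ : Phi s x - Phi s y = (Phi t x - Phi s y) - (Phi t x - Phi s x)); last by ring.
by rewrite (le_trans (ler_normB _ _)) // [leRHS]splitr lerD.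
Qed.

Lemma integrable_segment (f : R -> R) :
  (forall t, I01 t -> {for t, continuous f}) -> mu.-integrable I01 (EFin \o f).
Proof.
move=> cf; apply: continuous_compact_integrable; first exact: segment_compact.
by apply: continuous_in_subspaceT => t; rewrite inE => /cf.
Qed.

Lemma Rintegral_cst01 (c : R) : \int[mu]_(t in I01) c = c.
Proof.
rewrite Rintegral_cst //= lebesgue_measure_itv /= lte_fin ltr01 /=.
by rewrite subr0 mulr1.
Qed.

Lemma continuous_segment_integral (T : topologicalType) (Phi : R -> T -> R) (x : T) :
  (\forall y \near x, forall t, I01 t ->
     {for (t, y), continuous (fun p : R * T => Phi p.1 p.2)}) ->
  {for x, continuous (fun y => \int[mu]_(t in I01) Phi t y)}.
Proof.
move=> nPhi; have cPhi := nbhs_singleton nPhi.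
have ct y : (forall t, I01 t -> {for (t, y), continuous (fun p : R * T => Phi p.1 p.2)}) ->
    forall t, I01 t -> {for t, continuous (Phi ^~ y)}.
  move=> c t /c cy.
  by have := @continuous2_cvg _ _ _ _ (nbhs t) _ id (fun=> y) Phi t y cy
    cvg_id (cvg_cst y); apply; exact: nbhs_filter.
apply/cvgrPdist_le => e e0.
near=> y.
have cy : forall t, I01 t -> {for t, continuous (Phi ^~ y)} by apply: ct; near: y.
have cx := ct _ cPhi.
have cxy t : I01 t -> {for t, continuous (fun t => Phi t x - Phi t y)}.
  by move=> It; apply: continuousB; [exact: cx|exact: cy].
rewrite -RintegralB //; [|exact: integrable_segment..].
apply: le_trans (le_normr_Rintegral _ _) _ => //; first exact: integrable_segment.
rewrite -[leRHS]Rintegral_cst01; apply: le_Rintegral => //.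
- apply: integrable_segment => t It.
  by apply: continuous_comp; [exact: cxy|exact: norm_continuous].
- by apply: integrable_segment => t _; exact: cst_continuous.
- by near: y; exact: near_uniform_segment.
Unshelve. all: by end_near. Qed.

End ParameterIntegral.

Section Hadamard.
Context {R : realType} {n : nat}.
Local Notation mu := (@lebesgue_measure R).
Local Notation I01 := (unit_segment R).
Variables (q : 'rV[R]_n) (U : set 'rV[R]_n).
Hypothesis oU : open U.
Hypothesis starU : forall x t, U x -> I01 t -> U (q + t *: (x - q)).

(** The power of t makes the family of moments closed under differentiation: each derivative in [x]
    brings out one factor t, and smoothness follows by induction. *)
Let ray (m : nat) (F : 'rV[R]_n -> R) (t : R) (x : 'rV[R]_n) : R :=
  t ^+ m * F (q + t *: (x - q)).

Definition moment m F x : R := \int[mu]_(t in I01) ray m F t x.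

Let continuous_ray m F : (forall x, U x -> {for x, continuous F}) ->
  forall x t, U x -> I01 t ->
    {for (t, x), continuous (fun p : R * 'rV[R]_n => ray m F p.1 p.2)}.
Proof.
move=> cF x t Ux It.
apply: continuousM.
  apply: (@continuous_comp _ _ _ (fun p : R * 'rV[R]_n => p.1) (fun t => t ^+ m)).
    exact: cvg_fst.
  exact: exprn_continuous.
apply: (@continuous_comp _ _ _ (fun p : R * 'rV[R]_n => q + p.1 *: (p.2 - q)) F); last first.
  by apply: cF; exact: starU.
apply: cvgD; first exact: cvg_cst.
apply: cvgZ; first exact: cvg_fst.
by apply: cvgB; [exact: cvg_snd|exact: cvg_cst].
Qed.

Lemma moment_continuous m F x : (forall x, U x -> {for x, continuous F}) ->
  U x -> {for x, continuous (moment m F)}.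
Proof.
move=> cF Ux; apply: continuous_segment_integral.
near=> y => t It; apply: continuous_ray => //.
by near: y; exact: open_nbhs_nbhs.
Unshelve. all: by end_near. Qed.

Let continuous_ray1 m F x t : (forall x, U x -> {for x, continuous F}) ->
  U x -> I01 t -> {for t, continuous (ray m F ^~ x)}.
Proof.
move=> cF Ux It; have c := continuous_ray (m := m) cF Ux It.
by have := @continuous2_cvg _ _ _ _ (nbhs t) _ id (fun=> x) (ray m F) t x c
    cvg_id (cvg_cst x); apply; exact: nbhs_filter.
Qed.

Lemma is_derive_moment m F x i : Ck_on 1 U F -> U x ->
  is_derive x (delta_mx 0 i) (moment m F)
    (moment m.+1 (fun y => 'D_(delta_mx 0 i) F y) x).
Proof.
move=> [cF dF] Ux; set v := delta_mx 0 i : 'rV[R]_n.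
have [dFi [cdF _]] := dF i.
pose f (s t : R) := ray m F t (x + s *: v).
have df s t : U (x + s *: v) -> I01 t ->
    is_derive s 1 (f ^~ t) (ray m.+1 (fun y => 'D_v F y) t (x + s *: v)).
  move=> Us It.
  have E u : q + t *: (x + u *: v - q) = (q + t *: (x - q)) + (u * t) *: v.
    by rewrite addrAC scalerDr scalerA addrA [t * u]mulrC.
  have Ul : U ((q + t *: (x - q)) + (s * t) *: v) by rewrite -E; exact: starU.
  have dl := is_derive_line (dFi _ Ul).
  have dm : is_derive s 1 (fun u : R => u * t) t.
    have := is_deriveM (is_derive_id s 1) (is_derive_cst t s 1).
    by move=> /is_derive_eq; apply; rewrite scaler0 add0r [_ *: 1]mulr1.
  have dc := @is_derive1_comp R (fun a => F ((q + t *: (x - q)) + a *: v))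
    (fun u => u * t) s _ _ dl dm.
  have dz := is_deriveZ (t ^+ m) dc.
  rewrite (_ : f ^~ t = t ^+ m \*: ((fun a => F ((q + t *: (x - q)) + a *: v))
    \o (fun u => u * t))); last by apply/funext => u; rewrite /f /ray E.
  apply: is_derive_eq dz _; rewrite /ray E exprSr.
  by rewrite -[LHS]/(_ * _) [_ * t]mulrC mulrA.
have [d d0 dU] : exists2 d : R, 0 < d & forall s : R, `|s| <= d ->
    U (x + s *: v) /\ forall t, I01 t ->
    `|ray m.+1 (fun y => 'D_v F y) t x - ray m.+1 (fun y => 'D_v F y) t (x + s *: v)| <= 1.
  have : \forall y \near x, U y /\ forall t, I01 t ->
      `|ray m.+1 (fun y => 'D_v F y) t x - ray m.+1 (fun y => 'D_v F y) t y| <= 1.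
    near=> y; split; first by near: y; exact: open_nbhs_nbhs.
    near: y; apply: (@near_uniform_segment _ _ (ray m.+1 (fun y => 'D_v F y)) x) => // t It.
    exact: continuous_ray.
  move=> /nbhs_ballP[d /= d0 dH]; exists (d / 2); first by rewrite divr_gt0.
  move=> s sd; apply: dH; rewrite -ball_normE /= opprD addrA subrr sub0r normrN.
  rewrite normrZ (@le_lt_trans _ _ (`|s| * 1)) //.
    apply: ler_wpM2l => //; apply: rV_norm_le => // j.
    by rewrite mxE eqxx /=; case: (_ == _); rewrite ?normr1 ?normr0.
  by rewrite mulr1 (le_lt_trans sd) // ltr_pdivrMr // ltr_pMr // ltr1n.
have [C C0 HC] : exists2 C : R, 0 <= C & forall t, I01 t ->
    `|ray m.+1 (fun y => 'D_v F y) t x| <= C.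
  have [|c cI Hc] := @EVT_max R (fun t => `|ray m.+1 (fun y => 'D_v F y) t x|) 0 1 ler01.
    apply: continuous_in_subspaceT => t; rewrite inE => It.
    apply: (@continuous_comp _ _ _ (ray m.+1 (fun y => 'D_v F y) ^~ x) (fun u : R => `|u|)).
      exact: continuous_ray1.
    exact: norm_continuous.
  exists `|ray m.+1 (fun y => 'D_v F y) c x| => // t It; exact: Hc.
have I0 : (`]- d, d[%classic : set R) 0 by rewrite /= in_itv /= oppr_lt0 d0.
have Id s : (`]- d, d[%classic : set R) s -> `|s| <= d.
  by rewrite /= in_itv /= => /andP[s1 s2]; rewrite ler_norml !ltW.
have := @cvg_differentiation_under_integral R _ _ mu f I01
  (@measurable_itv _ `[0%R, 1%R]) 0 (- d) d I0.
have intf s : (`]- d, d[%classic : set R) s -> mu.-integrable I01 (EFin \o f s).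
  move=> /Id/dU[Us _]; apply: integrable_segment => t It; exact: continuous_ray1.
have derf s t : (`]- d, d[%classic : set R) s -> I01 t -> derivable (f ^~ t) s 1.
  by move=> /Id/dU[Us _] It; case: (df s t Us It).
have parf s t : (`]- d, d[%classic : set R) s -> I01 t ->
    partial1of2 f s t = ray m.+1 (fun y => 'D_v F y) t (x + s *: v).
  by move=> /Id/dU[Us _] It; rewrite partial1of2E; case: (df s t Us It).
(* The dominating constant: [C] bounds the derivative of the integrand at [x] over all of [0, 1],
   and by the choice of [d] moving [x] to [x + s *: v] changes it by at most 1. *)
move=> /(_ intf derf (cst (C + 1))) H.
have {}H : h^-1 *: (\int[mu]_(y in I01) f (h + 0) y - \int[mu]_(y in I01) f 0 y)
    @[h --> 0^'] --> \int[mu]_(y in I01) partial1of2 f 0 y.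
  apply: H => [t||s t Is It]; first exact: addr_ge0.
    by apply: integrable_segment => t _; exact: cst_continuous.
  rewrite (parf _ _ Is It); have [Us /(_ _ It) H1] := dU _ (Id _ Is).
  rewrite -[X in `|X|](subrK (ray m.+1 (fun y => 'D_v F y) t x)) addrC.
  by rewrite (le_trans (ler_normD _ _)) // lerD ?HC // distrC.
have EL : \int[mu]_(y in I01) partial1of2 f 0 y = moment m.+1 (fun y => 'D_v F y) x.
  apply: eq_Rintegral => t; rewrite inE => It; rewrite parf // scale0r addr0 //.
have EH : (fun h : R => h^-1 *: (\int[mu]_(y in I01) f (h + 0) y -
                                \int[mu]_(y in I01) f 0 y)) =
  (fun h : R => h^-1 *: ((moment m F \o shift x) (h *: v) - moment m F x)).
  apply/funext => h; congr (_ *: (_ - _)); apply: eq_Rintegral => t _.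
    by rewrite /f addr0 [x + _]addrC.
  by rewrite /f scale0r addr0.
rewrite EL EH in H.
apply: DeriveDef; last exact: cvg_lim H.
by apply/cvg_ex; exists (moment m.+1 (fun y => 'D_v F y) x).
Unshelve. all: by end_near. Qed.

Lemma Ck_on_moment k m F : Ck_on k U F -> Ck_on k U (moment m F).
Proof.
elim: k m F => [|k IH] m F HF.
  by split=> // x Ux; apply: moment_continuous => // y; exact: HF.1.
have HF1 : Ck_on 1 U F by exact: Ck_on_leq HF.
split=> [x Ux|i]; first by apply: moment_continuous => // y; exact: HF.1.
split=> [x Ux|]; first by case: (is_derive_moment m i HF1 Ux).
apply: (Ck_on_eq oU _ (IH m.+1 _ (HF.2 i).2)) => x Ux.
by case: (is_derive_moment m i HF1 Ux).
Qed.

(** The fundamental theorem of calculus along the segment from [q] to [x]: [G i] is the mean of the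
    i-th partial of [F] over that segment. *)
Lemma hadamard F : U q -> smooth_on U F ->
  exists2 G : 'I_n -> 'rV[R]_n -> R,
    (forall i, smooth_on U (G i)) /\ (forall i, G i q = 'D_(delta_mx 0 i) F q) &
    forall x, U x -> F x = F q + \sum_i (x - q) 0 i * G i x.
Proof.
move=> Uq sF; exists (fun i => moment 0 (fun y => 'D_(delta_mx 0 i) F y)).
  split=> [i k|i]; first by apply: Ck_on_moment; exact: ((sF k.+1).2 i).2.
  rewrite /moment (_ : ray _ _ ^~ q = fun=> 'D_(delta_mx 0 i) F q).
    exact: Rintegral_cst01.
  by apply/funext => t; rewrite /ray expr0 mul1r subrr scaler0 addr0.
move=> x Ux.
have dF t : I01 t -> differentiable F (q + t *: (x - q)).
  by move=> It; apply: (C1_differentiable oU _ (sF 1%N)); exact: starU.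
have dl t : I01 t -> is_derive t 1 (fun s : R => F (q + s *: (x - q)))
    (\sum_i (x - q) 0 i * ray 0 (fun y => 'D_(delta_mx 0 i) F y) t x).
  move=> It; have := is_derive_line (diff_derivable (v := x - q) (dF _ It)).
  move=> /is_derive_eq; apply; rewrite derive_sum_partials; last exact: dF.
  by apply: eq_bigr => i _; rewrite /ray expr0 mul1r.
have cray i t : I01 t ->
    {for t, continuous (ray 0 (fun y => 'D_(delta_mx 0 i) F y) ^~ x)}.
  move=> It; apply: continuous_ray1 => // y.
  by have [_ [c _]] := (sF 1%N).2 i; exact: c.
have cg i t : I01 t -> {for t, continuous (fun t : R =>
    (x - q) 0 i * ray 0 (fun y => 'D_(delta_mx 0 i) F y) t x)}.
  by move=> It; apply: continuousM; [exact: cst_continuous|exact: cray].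
have csum (r : seq 'I_n) t : I01 t -> {for t, continuous (fun t : R =>
    \sum_(i <- r) (x - q) 0 i * ray 0 (fun y => 'D_(delta_mx 0 i) F y) t x)}.
  by move=> It; apply: continuous_sum_at => i; exact: cg.
have clF t : I01 t -> {for t, continuous (fun s : R => F (q + s *: (x - q)))}.
  by move=> It; apply: differentiable_continuous; apply/derivable1_diffP; case: (dl _ It).
have FTC : \int[mu]_(t in I01)
      (\sum_i (x - q) 0 i * ray 0 (fun y => 'D_(delta_mx 0 i) F y) t x)
    = F x - F q.
  rewrite /Rintegral (@continuous_FTC2 _ _ (fun s : R => F (q + s *: (x - q)))) //=.
  - by rewrite scale1r scale0r addr0 [q + _]addrC subrK.
  - by apply: continuous_in_subspaceT => t; rewrite inE => It; exact: csum.
  - split=> [t It||].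
    + have It' : I01 t by exact: subset_itv_oo_cc It.
      by case: (dl _ It').
    + apply: cvg_at_right_filter; apply: clF.
      by rewrite /= in_itv /= lexx ler01.
    + apply: cvg_at_left_filter; apply: clF.
      by rewrite /= in_itv /= lexx ler01.
  - move=> t It; have It' : I01 t by exact: subset_itv_oo_cc It.
    by rewrite derive1E; case: (dl _ It').
rewrite -[LHS](subrK (F q)) addrC -FTC; congr (_ + _).
rewrite (_ : \sum_i _ = \sum_i \int[mu]_(t in I01)
    ((x - q) 0 i * ray 0 (fun y => 'D_(delta_mx 0 i) F y) t x)); last first.
  apply: eq_bigr => i _; rewrite RintegralZl //.
  by apply: integrable_segment => t It; exact: cray.
elim: (index_enum _) => [|i r IHr].
  rewrite big_nil -[RHS](Rintegral_cst01 (0 : R)).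
  by apply: eq_Rintegral => t _; rewrite big_nil.
rewrite big_cons -IHr -RintegralD //.
- by apply: eq_Rintegral => t _; rewrite big_cons.
- by apply: integrable_segment => t It; exact: cg.
- by apply: integrable_segment => t It; exact: csum.
Qed.

End Hadamard.

(** * Local frames *)

Lemma open_preimage_on (S T : topologicalType) (A : set S) (f : S -> T) (O : set T) :
  open A -> (forall x, A x -> {for x, continuous f}) -> open O ->
  open [set x | A x /\ O (f x)].
Proof.
move=> oA cf oO; rewrite openE => x [Ax Ofx].
have nA : nbhs x A by exact: open_nbhs_nbhs.
have nO : nbhs x (f @^-1` O) by apply: (cf _ Ax); exact: open_nbhs_nbhs.
by apply: filterS (filterI nA nO) => y [].
Qed.

Section ExtensionByZero.
Context {R : realType} (M : manifold R) (c : chart R M (Defs.dim M)).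
Hypothesis ac : atlas c.

Definition ext_by_zero (u : 'rV[R]_(Defs.dim M) -> R) : M -> R :=
  fun q => if `[< chart_dom c q >] then u (chart_map c q) else 0.

(** Checked locally in an arbitrary chart [d]. At points of [L], the copy of [K] in M, the
    transition map to [c] applies; elsewhere the function is locally zero, because [L] is compact
    and hence closed in the Hausdorff space M. *)
Lemma ext_by_zero_smooth (D K : set 'rV[R]_(Defs.dim M)) u :
  open D -> D `<=` chart_map c @` chart_dom c -> compact K -> K `<=` D ->
  smooth_on D u -> (forall y, ~ K y -> u y = 0) -> ext_by_zero u \in @smooth R M.
Proof.
move=> oD DW cK KD su u0; apply/asboolP => d ad k.
have KW : K `<=` chart_map c @` chart_dom c by move=> y /KD /DW.
pose L := chart_inv c @` K.
have cL : closed L.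
  apply: compact_closed; first exact: (@manifold_hausdorff _ M).
  apply: continuous_compact => //; apply: continuous_in_subspaceT => y.
  by rewrite inE => /KW; exact: chart_inv_continuous.
pose O := [set q | chart_dom c q /\ D (chart_map c q)].
have oO : open O.
  apply: open_preimage_on oD; first exact: chart_dom_open.
  exact: chart_map_continuous.
apply: Ck_on_local => _ [q dq <-].
have [Lq|nLq] := pselect (L q).
  have Oq : O q.
    have [y Ky yq] := Lq; have [q' dq' q'y] := KW _ Ky.
    by move: yq; rewrite -q'y chart_mapK // => <-; split=> //; apply: KD; rewrite q'y.
  pose W := [set y | (chart_map d @` chart_dom d) y /\ O (chart_inv d y)].
  have oW : open W.
    apply: open_preimage_on oO; first exact: chart_img_open.
    exact: chart_inv_continuous.
  exists W; first by split; [exists q|rewrite chart_mapK].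
  apply: (@Ck_on_eq _ _ _ _ (u \o (chart_map c \o chart_inv d))) => //.
    by move=> y [_ [dy _]] /=; rewrite /ext_by_zero asboolT.
  apply: (Ck_on_comp (V := D)) => // [y [_ []] //|j k'].
  apply: Ck_on_sub (atlas_compatible ad ac j k').
  move=> _ [[q' dq' <-]]; rewrite chart_mapK // => -[cq' _].
  by exists q'.
pose W := [set y | (chart_map d @` chart_dom d) y /\ (~` L) (chart_inv d y)].
have oW : open W.
  apply: open_preimage_on; first exact: chart_img_open.
    exact: chart_inv_continuous.
  exact: closed_openC.
exists W; first by split; [exists q|rewrite chart_mapK].
apply: (@Ck_on_eq _ _ _ _ (cst 0)) => //; last exact: Ck_on_cst.
move=> y [_ nL] /=; rewrite /ext_by_zero; case: asboolP => // cy.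
apply/esym/u0 => Ky; apply: nL; exists (chart_map c (chart_inv d y)) => //.
by rewrite chart_mapK.
Qed.

End ExtensionByZero.

(** Two norms are at work. [D] is a ball for the norm of row vectors, whose convexity serves
    Hadamard's lemma; [chi] is exp(-1/s) with s = r^2 minus the squared Euclidean distance, a
    polynomial. As r is half the radius of [D], the Euclidean ball [K] fits inside [D]. *)
Lemma smooth_bump (R : realType) (n : nat) (W : set 'rV[R]_n) (x0 : 'rV[R]_n) :
  open W -> W x0 ->
  exists D K : set 'rV[R]_n, exists chi : 'rV[R]_n -> R,
  [/\ [/\ open D, D `<=` W & forall x y t, D x -> D y ->
          unit_segment R t -> D (x + t *: (y - x))],
      compact K, K `<=` D,
      forall U, open U -> smooth_on U chi &
      [/\ forall y, 0 <= chi y, forall y, ~ K y -> chi y = 0 & 0 < chi x0]].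
Proof.
move=> oW Wx0.
have /nbhs_ballP[r0 /= r00 rW] : nbhs x0 W by exact: open_nbhs_nbhs.
pose r := r0 / 2.
have r_gt0 : 0 < r by rewrite divr_gt0.
pose s : 'rV[R]_n -> R := cst (r ^+ 2) + cst (-1) *
  \sum_i ((fun y : 'rV[R]_n => y 0 i) + cst (- x0 0 i)) *
         ((fun y : 'rV[R]_n => y 0 i) + cst (- x0 0 i)).
have sE y : s y = r ^+ 2 - \sum_i (y 0 i - x0 0 i) ^+ 2.
  rewrite /s /= /GRing.add /= /GRing.mul /= fct_sumE mulN1r; congr (_ - _).
have ss U : open U -> smooth_on U s.
  move=> oU k; apply: Ck_on_add => //; first exact: Ck_on_cst.
  apply: Ck_on_mul => //; first exact: Ck_on_cst.
  apply: Ck_on_sum => // i.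
  have H : Ck_on k U ((fun y : 'rV[R]_n => y 0 i) + cst (- x0 0 i)).
    by apply: Ck_on_add => //; [exact: Ck_on_coord|exact: Ck_on_cst].
  exact: Ck_on_mul.
have KD : [set y | 0 <= s y] `<=` closed_ball_ Num.norm x0 r.
  move=> y /=; rewrite sE subr_ge0 => H.
  apply: rV_norm_le => [|i]; first exact: ltW.
  rewrite !mxE -(@ler_pXn2r _ 2) // ?nnegrE ?(ltW r_gt0) //.
  rewrite real_normK ?num_real // (le_trans _ H) // (bigD1 i) //=.
  rewrite -[leLHS]addr0 -[x0 0 i - _]opprB sqrrN lerD2l.
  by apply: sumr_ge0 => j _; exact: sqr_ge0.
exists (ball x0 r0), [set y | 0 <= s y], (flat 0 \o s); split.
- split=> //; first exact: ball_open.
  move=> x y t; rewrite -ball_normE /= => xr yr; rewrite in_itv /= => /andP[t0 t1].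
  rewrite (_ : x0 - (x + t *: (y - x)) = (1 - t) *: (x0 - x) + t *: (x0 - y)); last first.
    by apply/rowP => i; rewrite !mxE; ring.
  rewrite (le_lt_trans (ler_normD _ _)) // !normrZ.
  rewrite (ger0_norm t0) ger0_norm ?subr_ge0 //.
  have [->|tn0] := eqVneq t 0; first by rewrite subr0 mul1r mul0r addr0.
  have tp : 0 < t by rewrite lt0r tn0.
  rewrite (_ : r0 = (1 - t) * r0 + t * r0); last by ring.
  by apply: ler_ltD; [rewrite ler_wpM2l ?subr_ge0 // ltW|rewrite ltr_pM2l].
- apply: bounded_closed_compact.
    exists (`|x0| + r); split; first exact: num_real.
    move=> e er y /KD /= H; apply: ltW; apply: le_lt_trans er.
    rewrite -[y](subrK x0) addrC (le_trans (ler_normD _ _)) // lerD2l.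
    by rewrite distrC.
  rewrite (_ : [set y | 0 <= s y] = s @^-1` [set t | 0 <= t]) //.
  apply: closed_comp; last exact: closed_ge.
  by move=> y _; have [] := ss setT openT 0%N; exact.
- move=> y /KD /=; rewrite -ball_normE /=; move=> H; apply: le_lt_trans H _.
  by rewrite ltr_pdivrMr // ltr_pMr // ltr1n.
- by move=> U oU k; apply: Ck_on_flat => //; exact: ss.
- split=> [y|y /= /negP|]; first exact: flat_ge0.
    by rewrite -ltNge /flat => sy; rewrite ltNge (ltW sy).
  rewrite /= flat_gt0 sE big1 ?subr0 ?exprn_gt0 // => i _.
  by rewrite subrr expr0n.
Qed.

Lemma smoothFun_smooth_on (R : realType) (M : manifold R) (c : chart R M (Defs.dim M))
    (f : 'C^oo(M)) : atlas c ->
  smooth_on (chart_map c @` chart_dom c) (f \o chart_inv c).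
Proof. by move=> ac; have /asboolP/(_ c ac) := smooth_funP f. Qed.

Lemma smoothFunP (R : realType) (M : manifold R) (f g : 'C^oo(M)) :
  (forall p, f p = g p) -> f = g.
Proof. by move=> fg; apply/val_inj/funext. Qed.

Lemma vectorFieldP (R : realType) (M : manifold R) (X Y : vectorField M) :
  (forall f p, (X f : 'C^oo(M)) p = (Y f : 'C^oo(M)) p) -> X = Y.
Proof. by move=> XY; apply/val_inj/funext => f; apply: smoothFunP => p; exact: XY. Qed.

(** * Rules of calculus for derivations *)

Section VectorFieldCalculus.
Context {R : realType} (M : manifold R).
Local Notation A := 'C^oo(M).
Local Notation V := (vectorField M).

Lemma vf_cst (X : V) (k : R) : X (k *: (1 : A)) = 0.
Proof.
have /asboolP[_ XZ XM] := vf_derivation X.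
suff X1 : X 1 = 0 by rewrite XZ X1 scaler0.
have := XM 1 1; rewrite mulr1 !mul1r => H.
by apply: (@addrI _ (X 1)); rewrite -H addr0.
Qed.

Lemma vfD (X : V) (f g : A) : X (f + g) = X f + X g.
Proof. by have /asboolP[XD _ _] := vf_derivation X. Qed.

Lemma vfM (X : V) (f g : A) : X (f * g) = f * X g + g * X f.
Proof. by have /asboolP[_ _ XM] := vf_derivation X. Qed.

Lemma vfZ (X : V) k (f : A) : X (k *: f) = k *: (X f : A).
Proof. by have /asboolP[_ XZ _] := vf_derivation X. Qed.

Lemma vfN (X : V) (f : A) : X (- f) = - X f.
Proof. by rewrite -scaleN1r vfZ scaleN1r. Qed.

Lemma vf0 (X : V) : X 0 = 0.
Proof. by apply: (@addrI _ (X 0)); rewrite -vfD !addr0. Qed.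

Lemma vf_sum (X : V) m (F : 'I_m -> A) : X (\sum_i F i) = \sum_i X (F i).
Proof. by elim/big_rec2: _ => [|i y1 y2 _ <-]; rewrite ?vf0 ?vfD. Qed.

Lemma smoothFun_sumE m (F : 'I_m -> A) q : (\sum_i F i) q = \sum_i F i q.
Proof. by elim: (index_enum _) => [|i r IH]; rewrite ?big_nil ?big_cons // -IH. Qed.

Lemma vf_sumE m (a : 'I_m -> A) (E : 'I_m -> V) (f : A) q :
  ((\sum_i a i *: E i) f : A) q = \sum_i a i q * (E i f : A) q.
Proof.
have -> : ((\sum_i a i *: E i) f : A) = \sum_i a i * (E i f : A).
  by elim: (index_enum _) => [|i r IH]; rewrite ?big_nil ?big_cons // -IH.
exact: smoothFun_sumE.
Qed.

End VectorFieldCalculus.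

Section LocalFrame.
Context {R : realType} (M : manifold R) (c : chart R M (Defs.dim M)).
Hypothesis ac : atlas c.
Local Notation n := (Defs.dim M).
Local Notation A := 'C^oo(M).
Local Notation V := (vectorField M).
Variables (D K : set 'rV[R]_n) (chi : 'rV[R]_n -> R).
Hypotheses (oD : open D) (DW : D `<=` chart_map c @` chart_dom c)
  (convD : forall x y t, D x -> D y ->
     unit_segment R t -> D (x + t *: (y - x)))
  (cK : compact K) (KD : K `<=` D) (schi : smooth_on D chi)
  (chi0 : forall y, ~ K y -> chi y = 0).

Lemma cutoff_smooth u : smooth_on D u -> ext_by_zero c (chi * u) \in @smooth R M.
Proof.
move=> su; apply: (ext_by_zero_smooth ac oD DW cK KD).
  by move=> k; apply: Ck_on_mul.
by move=> y Ky; rewrite /GRing.mul /= chi0 // mul0r.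
Qed.

Definition cutoff u (su : smooth_on D u) : A := SmoothFun (cutoff_smooth su).

(** The alternative depends on [q] alone and holds for all functions [u] at once, so an identity
    between several cutoffs needs a single case split. *)
Lemma cutoff_cases q :
  (chart_dom c q /\ D (chart_map c q) /\
     forall u (su : smooth_on D u), cutoff su q = chi (chart_map c q) * u (chart_map c q)) \/
  (forall u (su : smooth_on D u), cutoff su q = 0).
Proof.
rewrite /cutoff /= /ext_by_zero; case: (asboolP (chart_dom c q)) => cq; last by right.
have [Kq|nKq] := pselect (K (chart_map c q)).
  by left; split=> //; split; [exact: KD|].
by right => u su; rewrite /GRing.mul /= chi0 // mul0r.
Qed.

Lemma partial_smooth (f : A) i :
  smooth_on D (fun y => 'D_(delta_mx 0 i) (f \o chart_inv c) y).
Proof.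
by move=> k; have [_ s] := (smoothFun_smooth_on f ac k.+1).2 i; exact: Ck_on_sub s.
Qed.

Lemma chart_partial_derivable (f : A) i y : D y ->
  derivable (f \o chart_inv c) y (delta_mx 0 i).
Proof. by move=> /DW Wy; exact: ((smoothFun_smooth_on f ac 1%N).2 i).1. Qed.

Lemma frame_derivation i :
  ((fun f => cutoff (partial_smooth f i)) : A -> A^o) \in @derivation R M.
Proof.
pose e f : A := cutoff (partial_smooth f i).
apply/asboolP; split=> [f g|k f|f g]; apply: smoothFunP => q.
- have [[cq [Dq E]]|E] := cutoff_cases q; last first.
    by rewrite -[RHS]/(e f q + e g q) !E addr0.
  rewrite -[RHS]/(e f q + e g q) !E -mulrDr; congr (_ * _).
  by rewrite -deriveD //; exact: chart_partial_derivable.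
- have [[cq [Dq E]]|E] := cutoff_cases q; last first.
    by rewrite -[RHS]/(k * e f q) !E mulr0.
  rewrite -[RHS]/(k * e f q) !E mulrCA; congr (_ * _).
  by rewrite -[RHS]deriveZ //; exact: chart_partial_derivable.
- have [[cq [Dq E]]|E] := cutoff_cases q; last first.
    by rewrite -[RHS]/(f q * e g q + g q * e f q) !E !mulr0 addr0.
  rewrite -[RHS]/(f q * e g q + g q * e f q) !E !(mulrCA _ (chi _)) -mulrDr.
  congr (_ * _); have := deriveM (@chart_partial_derivable f i _ Dq)
    (@chart_partial_derivable g i _ Dq).
  by rewrite /= chart_mapK.
Qed.

Definition frame i : V := VectorField (frame_derivation i).

Lemma one_smooth : smooth_on D (cst 1 : 'rV[R]_n -> R).
Proof. by move=> k; exact: Ck_on_cst. Qed.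

(** The bump function itself as a global function on M: the factor psi carried by every
    [frame i]. *)
Definition frame_weight : A := cutoff one_smooth.

Lemma coord_smooth i : smooth_on D (fun y : 'rV[R]_n => y 0 i).
Proof. by move=> k; exact: Ck_on_coord. Qed.

(* Hadamard's lemma at the point [q], cut off by [chi^2], exhibits [f - f q] as
   a combination of the coordinates centred at [q]. *)
Lemma frame_expansion (X : V) :
  exists a : 'I_n -> A, frame_weight ^+ 3 *: X = \sum_i a i *: frame i.
Proof.
pose psi := frame_weight; pose Y i : A := cutoff (coord_smooth i).
(* Two powers of [psi] come from cutting off both factors of Hadamard's formula. The third replaces
   the coordinate of [q], a number depending on the point, by [Y i q / psi q], which turns the
   coefficients into global smooth functions. *)
exists (fun i => psi * (X (Y i) : A) - Y i * (X psi : A)).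
apply: vectorFieldP => f q; rewrite vf_sumE.
rewrite -[LHS]/(psi q ^+ 3 * (X f : A) q).
have [[cq [Dq E]]|E] := cutoff_cases q; last first.
  rewrite [psi q]E expr0n mul0r big1 // => i _.
  by rewrite -[frame i f]/(cutoff _) E mulr0.
set y := chart_map c q in Dq E *.
have starD x t : D x -> unit_segment R t -> D (y + t *: (x - y)).
  by move=> Dx It; exact: convD.
have sf : smooth_on D (f \o chart_inv c).
  by move=> k; exact: Ck_on_sub (smoothFun_smooth_on f ac k).
have [G [sG Gy] HG] := hadamard oD starD Dq sf.
have key : psi ^+ 2 * (f - f q *: (1 : A)) =
    \sum_i (Y i - y 0 i *: psi) * cutoff (sG i).
  apply: smoothFunP => q'; rewrite smoothFun_sumE.
  rewrite -[LHS]/(psi q' ^+ 2 * (f q' - f q * 1)).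
  have [[cq' [Dq' E']]|E'] := cutoff_cases q'; last first.
    rewrite [psi q']E' expr0n mul0r big1 // => i _.
    by rewrite -[LHS]/(_ q' * _ q') [X in _ * X]E' mulr0.
  rewrite [psi q']E' /cst mulr1.
  have := HG _ Dq'; rewrite /= !chart_mapK // => ->.
  rewrite mulr1 addrC addKr mulr_sumr; apply: eq_bigr => i _.
  rewrite -[RHS]/((Y i q' - y 0 i * psi q') * cutoff (sG i) q').
  rewrite [Y i q']E' [psi q']E' [cutoff _ _]E' !mxE /cst.
  by ring.
have psiq : psi q = chi y by rewrite [psi q]E /cst mulr1.
(* At [q] both [f - f q] and [Y i - y 0 i *: psi] vanish, so in each product only the derivative of
   the vanishing factor survives. *)
have := congr1 (fun h => (X h : A) q) key.
rewrite vfM vf_sum smoothFun_sumE vfD vfN vf_cst.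
rewrite -[LHS]/(psi q ^+ 2 * ((X f : A) q - 0) + (f q - f q * 1) * (X (psi ^+ 2) : A) q).
rewrite subr0 mulr1 subrr mul0r addr0 => H.
rewrite exprS -mulrA H mulr_sumr; apply: eq_bigr => i _.
rewrite vfM vfD vfN vfZ.
rewrite -[LHS]/(psi q * ((Y i q - y 0 i * psi q) * (X (cutoff (sG i)) : A) q +
  cutoff (sG i) q * ((X (Y i) : A) q - y 0 i * (X psi : A) q))).
rewrite -[RHS]/((psi q * (X (Y i) : A) q - Y i q * (X psi : A) q) * (frame i f) q).
rewrite -[frame i f]/(cutoff _) [Y i q]E [cutoff (sG i) q]E [cutoff _ q]E -psiq Gy.
by ring.
Qed.

End LocalFrame.

(** * Maxima and quadratic forms along curves *)

Lemma is_derive_gt0_near (R : realType) (f : R -> R) (t l : R) :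
  is_derive t 1 f l -> 0 < l ->
  exists2 e : R, 0 < e & forall h, h != 0 -> `|h| < e -> 0 < (f (t + h) - f t) / h.
Proof.
move=> [df lE] l0.
have H : h^-1 *: ((f \o shift t) (h *: 1) - f t) @[h --> 0^'] --> l.
  by rewrite -lE; exact: df.
have /cvgr_gt/(_ _ l0) := H.
move=> /nbhs_ballP[e /= e0 eP]; exists e => // h h0 he.
have := eP h; rewrite -ball_normE /= sub0r normrN => /(_ he h0).
by rewrite /= [h *: 1]mulr1 [_ / h]mulrC [t + h]addrC.
Qed.

(** The first derivative is taken in the form [w / rho] because along chart segments the fields
    [E i] are psi times coordinate fields. The sign of [rho] then suffices: if l > 0, [w] is
    positive just after 0 and [k] exceeds its maximum. *)
Lemma second_derivative_at_max (R : realType) (k w rho : R -> R) (l e : R) :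
  0 < e -> (forall t : R, `|t| < e -> is_derive t 1 k (w t / rho t)) ->
  (forall t : R, `|t| < e -> 0 < rho t) ->
  (forall t, k t <= k 0) -> is_derive (0 : R) 1 w l -> w 0 = 0 /\ l <= 0.
Proof.
move=> e0 dk rho0 kmax dw.
have w0 : w 0 = 0.
  have inE (t : R) : t \in `]- e, e[%R -> `|t| < e by rewrite in_itv /= ltr_norml.
  have Ie0 : (0 : R) \in `]- e, e[%R by rewrite in_itv /= oppr_lt0 e0.
  have [||_ k0] := @derive1_at_max R k (- e) e 0 _ _ Ie0 (fun t _ => kmax t).
  - by rewrite ge0_cp // ltW.
  - by move=> t /inE/dk[].
  have [_] := dk 0 (inE _ Ie0); rewrite k0 => /esym/eqP.
  by rewrite mulf_eq0 invr_eq0 (gt_eqF (rho0 _ (inE _ Ie0))) orbF => /eqP.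
split=> //; rewrite leNgt; apply/negP => l0.
have [d d0 dP] := is_derive_gt0_near dw l0.
pose s := Num.min d e / 2.
have s0 : 0 < s by rewrite divr_gt0 // lt_min d0.
have sde : s < Num.min d e by rewrite ltr_pdivrMr // ltr_pMr ?ltr1n // lt_min d0.
move: sde; rewrite lt_min => /andP[sd se].
have [||c cI kE] := MVT s0 (f := k) (df := fun t => w t / rho t).
- move=> t; rewrite in_itv /= => /andP[t0 ts]; apply: dk.
  by rewrite gtr0_norm // (lt_trans ts).
- apply: derivable_within_continuous => t; rewrite in_itv /= => /andP[t0 ts].
  have [] // := dk t _; rewrite ger0_norm //; exact: le_lt_trans ts se.
have := kmax s; rewrite -subr_le0 kE subr0 leNgt => /negP; apply.
move: cI; rewrite in_itv /= => /andP[c0 cs].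
rewrite mulr_gt0 // divr_gt0 //; last by rewrite rho0 // gtr0_norm // (lt_trans cs).
have := dP c; rewrite gt_eqF // gtr0_norm // add0r w0 subr0.
by move=> /(_ isT (lt_trans cs sd)); rewrite pmulr_lgt0 // invr_gt0.
Qed.

Section QuadraticForms.
Context {R : realType} {n : nat}.
Implicit Types (x y : 'rV[R]_n) (H G : 'M[R]_n).

Definition mxform H x y : R := (x *m H *m y^T) 0 0.

Lemma mxformE H x y : mxform H x y = \sum_i \sum_j x 0 i * H i j * y 0 j.
Proof.
rewrite /mxform mxE exchange_big /=; apply: eq_bigr => j _.
by rewrite !mxE mulr_suml; apply: eq_bigr => i _.
Qed.

Lemma mxformDl H x y z : mxform H (x + y) z = mxform H x z + mxform H y z.
Proof. by rewrite /mxform !mulmxDl mxE. Qed.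

Lemma mxformDr H x y z : mxform H x (y + z) = mxform H x y + mxform H x z.
Proof. by rewrite /mxform linearD /= mulmxDr mxE. Qed.

Lemma mxformZl H a x y : mxform H (a *: x) y = a * mxform H x y.
Proof. by rewrite /mxform -!scalemxAl mxE. Qed.

Lemma mxformZr H a x y : mxform H x (a *: y) = a * mxform H x y.
Proof. by rewrite /mxform linearZ /= -scalemxAr mxE. Qed.

Lemma mxform_sym H x y : H^T = H -> mxform H x y = mxform H y x.
Proof.
move=> Hs.
have E : (y *m H *m x^T)^T = x *m H *m y^T by rewrite !trmx_mul trmxK Hs mulmxA.
by rewrite /mxform -E mxE.
Qed.

(** The Cauchy-Schwarz argument: a linear term in s cannot be compensated by a quadratic one near s
    = 0. *)
Lemma mxform_null H x y : H^T = H -> (forall z, 0 <= mxform H z z) ->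
  mxform H x x = 0 -> mxform H x y = 0.
Proof.
move=> Hs Hp Hx.
have P s : 0 <= (mxform H x y *+ 2) * s + mxform H y y * s ^+ 2.
  rewrite (_ : _ + _ = mxform H (x + s *: y) (x + s *: y)) //.
  rewrite mxformDl !mxformDr !mxformZl !mxformZr Hx (mxform_sym y x Hs).
  by ring.
set b := mxform H x y in P *; set c := mxform H y y in P.
have c0 : 0 <= c by exact: Hp.
(* The minimiser would be - b / c; adding 1 keeps the denominator positive when c = 0, and the value
   is still negative unless b = 0. *)
have := P (- b / (c + 1)).
have c1 : 0 < c + 1 by rewrite ltr_wpDl.
have -> : b *+ 2 * (- b / (c + 1)) + c * (- b / (c + 1)) ^+ 2 =
    - (b ^+ 2 * (c + 2) / (c + 1) ^+ 2).
  by field; rewrite gt_eqF.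
rewrite oppr_ge0 pmulr_lle0 ?invr_gt0 ?exprn_gt0 //.
rewrite pmulr_lle0 ?ltr_wpDl // => b2.
by apply/eqP; rewrite -sqrf_eq0 eq_le b2 sqr_ge0.
Qed.

Lemma mxform_bound H x (C : R) : (forall i j, `|H i j| <= C) ->
  `|mxform H x x| <= C * n%:R * mxform 1%:M x x.
Proof.
move=> HC.
have E1 : mxform 1%:M x x = \sum_i x 0 i ^+ 2.
  by rewrite /mxform mulmx1 mxE; apply: eq_bigr => i _; rewrite mxE.
(* In dimension 0 no matrix entry is available to show [0 <= C]. *)
have [n0|n0] := posnP n.
  rewrite mxformE big1 ?normr0 ?E1 ?big1 ?mulr0 //.
    by move=> i; exfalso; move: (ltn_ord i); rewrite {2}n0.
  by move=> i; exfalso; move: (ltn_ord i); rewrite {2}n0.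
have C0 : 0 <= C by apply: le_trans (HC (Ordinal n0) (Ordinal n0)).
rewrite mxformE (le_trans (ler_norm_sum _ _ _)) //.
apply: (@le_trans _ _ (\sum_i \sum_j C * ((x 0 i ^+ 2 + x 0 j ^+ 2) / 2))).
  apply: ler_sum => i _; rewrite (le_trans (ler_norm_sum _ _ _)) //.
  apply: ler_sum => j _; rewrite mulrAC normrM mulrC.
  apply: ler_pM => //; rewrite ler_norml.
  have h1 := sqr_ge0 (x 0 i + x 0 j); have h2 := sqr_ge0 (x 0 i - x 0 j).
  by apply/andP; split; nra.
rewrite E1 le_eqVlt; apply/orP; left; apply/eqP.
under eq_bigr do rewrite -mulr_sumr -mulr_suml big_split /= sumr_const card_ord.
rewrite -mulr_sumr -mulr_suml big_split /= sumr_const card_ord sumrMnl -mulr_natl.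
by rewrite mulr1 -[X in X + X]mulr_natl; field.
Qed.


(* Minimise [exp (- L t) x H(t) x^T] over [0, 1] and the unit sphere: at a
   negative minimum [x] is an eigenvector of [H t] for a negative eigenvalue
   [mu], so the derivative in [t] is
   [exp (- L t) mu (- L + 2 x G(t) x^T) > 0] for [L] large, which is
   impossible as [t > 0]. *)
Lemma psd_linear_ode (H G : R -> 'M[R]_n) (C : R) :
  (forall t, unit_segment R t -> (H t)^T = H t) ->
  (forall t, unit_segment R t -> forall i j,
     is_derive t 1 (fun s => H s i j) ((G t *m H t + H t *m (G t)^T) i j)) ->
  (forall t, unit_segment R t -> forall i j, `|G t i j| <= C) ->
  (forall x, 0 <= mxform (H 0) x x) -> forall x, 0 <= mxform (H 1) x x.
Proof.
move=> Hs dH GC H0 x1; rewrite leNgt; apply/negP => neg1.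
pose N x := mxform 1%:M x x.
have NE x : N x = \sum_i x 0 i ^+ 2.
  by rewrite /N /mxform mulmx1 mxE; apply: eq_bigr => i _; rewrite mxE.
have N_ge0 x : 0 <= N x by rewrite NE; apply: sumr_ge0 => i _; exact: sqr_ge0.
have N_gt0 x : x != 0 -> 0 < N x.
  move=> x0; rewrite lt0r N_ge0 andbT; apply: contra x0; rewrite NE.
  rewrite psumr_eq0 => [/allP h|i _]; last exact: sqr_ge0.
  apply/eqP/rowP => i; rewrite mxE; apply/eqP.
  by have := h i (mem_index_enum _); rewrite sqrf_eq0.
pose unitize x := (Num.sqrt (N x))^-1 *: x.
have Nu x : x != 0 -> N (unitize x) = 1.
  move=> /N_gt0 Nx; rewrite /N /unitize mxformZl mxformZr -/(N x) mulrA -expr2.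
  by rewrite exprVn sqr_sqrtr ?(ltW Nx) // mulVf // gt_eqF.
pose S : set (R * 'rV[R]_n) := [set p | unit_segment R p.1 /\ N p.2 = 1].
(* By [mxform_bound], 2 x G x^T is at most 2 C n on unit vectors, so - L + 2 x G x^T stays
   negative. *)
pose L := 2 * (C * n%:R) + 1.
pose Phi (p : R * 'rV[R]_n) := expR (- L * p.1) * mxform (H p.1) p.2 p.2.
have x10 : x1 != 0.
  by apply: contraTneq neg1 => ->; rewrite /mxform !mul0mx mxE ltxx.
have S1 : S (1, unitize x1) by split; [rewrite /= in_itv /= ler01 lexx|exact: Nu].
have cS : compact S.
  have -> : S = unit_segment R `*` [set x | N x = 1] by [].
  apply: compact_setX; first exact: segment_compact.
  apply: bounded_closed_compact.
    exists 1; split; first exact: num_real.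
    move=> e e1 x /= Nx1; apply: ltW; apply: le_lt_trans e1.
    apply: rV_norm_le => // i; rewrite -(@ler_pXn2r _ 2) ?nnegrE // expr1n.
    rewrite real_normK ?num_real // -Nx1 NE (bigD1 i) //= lerDl.
    by apply: sumr_ge0 => j _; exact: sqr_ge0.
  rewrite (_ : [set x | N x = 1] = N @^-1` [set 1]) //.
  apply: closed_comp; last exact: closed_eq.
  move=> x _; have -> : N = fun x => \sum_i x 0 i ^+ 2 by apply/funext.
  apply: continuous_sum_at => i.
  apply: (@continuous_comp _ _ _ (fun x : 'rV[R]_n => x 0 i) (fun u : R => u ^+ 2)).
    exact: coord_continuous.
  exact: exprn_continuous.
have cPhi : {within S, continuous Phi}.
  apply: continuous_in_subspaceT => -[t x]; rewrite inE => -[/= It _].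
  have c1 : {for (t, x), continuous (fun p : R * 'rV[R]_n => expR (- L * p.1))}.
    apply: (@continuous_comp _ _ _ (fun p : R * 'rV[R]_n => - L * p.1) expR).
      by apply: cvgM; [exact: cvg_cst|exact: cvg_fst].
    exact: continuous_expR.
  suff c2 : {for (t, x), continuous (fun p : R * 'rV[R]_n => mxform (H p.1) p.2 p.2)}.
    exact: continuousM c1 c2.
  have -> : (fun p : R * 'rV[R]_n => mxform (H p.1) p.2 p.2) =
      fun p => \sum_i \sum_j p.2 0 i * H p.1 i j * p.2 0 j.
    by apply/funext => p; rewrite mxformE.
  apply: continuous_sum_at => i.
  apply: continuous_sum_at => j.
  have cc k : {for (t, x), continuous (fun p : R * 'rV[R]_n => p.2 0 k)}.
    apply: (@continuous_comp _ _ _ (fun p : R * 'rV[R]_n => p.2)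
      (fun x : 'rV[R]_n => x 0 k)).
      exact: cvg_snd.
    exact: coord_continuous.
  apply: continuousM; [apply: continuousM|] => //.
  apply: (@continuous_comp _ _ _ (fun p : R * 'rV[R]_n => p.1) (fun t => H t i j)).
    exact: cvg_fst.
  by apply: differentiable_continuous; apply/derivable1_diffP; case: (dH _ It i j).
have [|[t0 x0] + Pmin] := compact_EVT_min _ cS cPhi; first by exists (1, unitize x1).
rewrite inE => -[/= It0 Nx0].
have E0 t : 0 < expR (- L * t) := expR_gt0 _.
pose m := mxform (H t0) x0 x0.
have m_lt0 : m < 0.
  have := Pmin _ (mem_set S1); rewrite /Phi /= => P.
  have : expR (- L * t0) * m < 0.
    apply: le_lt_trans P _; rewrite pmulr_rlt0 // /unitize mxformZl mxformZr mulrA.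
    rewrite pmulr_rlt0 // -expr2 exprn_gt0 // invr_gt0 sqrtr_gt0.
    exact: N_gt0.
  by rewrite pmulr_rlt0.
have Hm : (H t0 - m%:M)^T = H t0 - m%:M by rewrite linearB /= tr_scalar_mx Hs.
have EHm x y : mxform (H t0 - m%:M) x y = mxform (H t0) x y - m * mxform 1%:M x y.
  rewrite /mxform mulmxBr mulmxBl mxE [in X in _ + X]mxE; congr (_ - _).
  by rewrite mulmx1 mul_mx_scalar -scalemxAl mxE.
have Hpos x : 0 <= mxform (H t0 - m%:M) x x.
  have [->|xn0] := eqVneq x 0; first by rewrite /mxform !mul0mx mxE.
  have Su : S (t0, unitize x) by split; last exact: Nu.
  have := Pmin _ (mem_set Su); rewrite /Phi /= ler_pM2l // -/m => P.
  have Nx := N_gt0 _ xn0.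
  rewrite EHm subr_ge0 -/(N x) -ler_pdivlMr //.
  rewrite (le_trans P) // /unitize mxformZl mxformZr mulrA -expr2 exprVn.
  by rewrite sqr_sqrtr ?(ltW Nx) // mulrC.
have Hx0 : mxform (H t0 - m%:M) x0 x0 = 0.
  by rewrite EHm -/(N x0) Nx0 mulr1 subrr.
(* Minimality over the sphere makes [H t0 - m] semidefinite with null vector [x0], and a null vector
   of a semidefinite form lies in its kernel. *)
have Heig y : mxform (H t0) x0 y = m * mxform 1%:M x0 y.
  by apply/eqP; rewrite -subr_eq0 -EHm; apply/eqP/mxform_null.
have dPhi : is_derive t0 1 (fun t => Phi (t, x0))
   (expR (- L * t0) * (m * (- L + 2 * mxform (G t0) x0 x0))).
  have dq : is_derive t0 1 (fun t => mxform (H t) x0 x0)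
      (mxform (G t0 *m H t0 + H t0 *m (G t0)^T) x0 x0).
    rewrite (_ : (fun t => _) =
      \sum_i \sum_j (fun t => x0 0 i * H t i j * x0 0 j)); last first.
      apply/funext => t; rewrite mxformE fct_sumE; apply: eq_bigr => i _.
      by rewrite fct_sumE.
    rewrite mxformE; apply: is_derive_sum => i; apply: is_derive_sum => j.
    rewrite (_ : (fun t => _) = (x0 0 i * x0 0 j) \*: (fun t => H t i j)); last first.
      by apply/funext => t; rewrite mulrAC.
    have := is_deriveZ (x0 0 i * x0 0 j) (dH _ It0 i j).
    by move=> /is_derive_eq; apply; rewrite [LHS]mulrAC.
  have de : is_derive t0 1 (fun t => expR (- L * t)) (expR (- L * t0) * - L).
    apply: (@is_derive1_comp R expR (fun t => - L * t)).
    have := is_deriveZ (- L) (is_derive_id t0 1).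
    by move=> /is_derive_eq; apply; rewrite [LHS]mulr1.
  have := is_deriveM de dq; move=> /is_derive_eq; apply.
  have -> : mxform (G t0 *m H t0 + H t0 *m (G t0)^T) x0 x0 =
      m * mxform (G t0) x0 x0 *+ 2.
    have GE : mxform 1%:M x0 (x0 *m G t0) = mxform (G t0) x0 x0.
      by rewrite (mxform_sym x0) ?tr_scalar_mx // /mxform mulmx1.
    have e1 : mxform (G t0 *m H t0) x0 x0 = mxform (H t0) x0 (x0 *m G t0).
      by rewrite mxform_sym ?Hs // /mxform mulmxA.
    have e2 : mxform (H t0 *m (G t0)^T) x0 x0 = mxform (H t0) x0 (x0 *m G t0).
      by rewrite /mxform trmx_mul !mulmxA.
    rewrite [LHS](_ : _ = mxform (G t0 *m H t0) x0 x0 +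
      mxform (H t0 *m (G t0)^T) x0 x0).
      by rewrite e1 e2 Heig GE mulr2n.
    by rewrite /mxform mulmxDr mulmxDl mxE.
  rewrite -/m -[LHS]/(_ * _ + _ * _); ring.
have t0_gt0 : 0 < t0.
  move: It0; rewrite /= in_itv /= => /andP[]; rewrite le_eqVlt => /predU1P[t00|//] _.
  by move: m_lt0; rewrite /m -t00 ltNge H0.
have pos : 0 < expR (- L * t0) * (m * (- L + 2 * mxform (G t0) x0 x0)).
  rewrite pmulr_rgt0 // nmulr_rgt0 // addrC subr_lt0 /L.
  have := mxform_bound x0 (GC _ It0); rewrite -/(N x0) Nx0 mulr1.
  move=> /(le_trans (ler_norm _)) B.
  by rewrite (@le_lt_trans _ _ (2 * (C * n%:R))) ?ler_pM2l // ltrDl.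
have [e e0 eP] := is_derive_gt0_near dPhi pos.
(* A step to the left, where [Phi] is smaller since its derivative at [t0] is positive; it remains
   in [0, 1] because [t0] is positive. *)
pose h := - (Num.min e t0 / 2).
have h1 : 0 < Num.min e t0 / 2 by rewrite divr_gt0 // lt_min e0.
have h2 : Num.min e t0 / 2 < Num.min e t0.
  by rewrite ltr_pdivrMr // ltr_pMr ?ltr1n // lt_min e0.
move: h2; rewrite lt_min => /andP[he ht].
have := eP h; rewrite /h oppr_eq0 gt_eqF // normrN gtr0_norm // => /(_ isT he).
rewrite nmulr_lgt0 ?invr_lt0 ?oppr_lt0 // subr_lt0 ltNge.
rewrite Pmin // inE; split=> //=.
move: It0; rewrite /= !in_itv /= => /andP[_ t01].
by rewrite subr_ge0 (ltW ht) lerBlDr (le_trans t01) // lerDl ltW.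
Qed.

End QuadraticForms.

Lemma smoothFun_continuous (R : realType) (M : manifold R) (f : 'C^oo(M)) :
  continuous (f : M -> R).
Proof.
move=> p; have [c ac cp] := atlas_cover p.
have cf : {for chart_map c p, continuous (f \o chart_inv c)}.
  by apply: Ck_on_continuous (smoothFun_smooth_on f ac 0%N) _; exists p.
have cfc : {for p, continuous ((f \o chart_inv c) \o chart_map c)}.
  by apply: continuous_comp cf; exact: chart_map_continuous.
have E : \forall q \near p, ((f \o chart_inv c) \o chart_map c) q = f q.
  have : nbhs p (chart_dom c) by apply: open_nbhs_nbhs; split=> //; exact: chart_dom_open.
  by apply: filterS => q cq /=; rewrite chart_mapK.
have := cfc; rewrite /prop_for /continuous_at /= chart_mapK //.
by move=> H; apply: cvg_trans H; exact: near_eq_cvg.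
Qed.

(** * Chart segments and the second-order test at a maximum *)

Section LocalFrames.
Context {R : realType} (M : manifold R).
Local Notation n := (Defs.dim M).
Local Notation A := 'C^oo(M).
Local Notation V := (vectorField M).

(** [gamma u] is a straight line in a chart, and dividing by [psi] undoes the factor contained in
    the fields [E i]. The range [|t| < 2] puts the whole of [0, 1] in the interior, so that
    derivatives at both ends are two-sided. *)
Lemma local_frame (p : M) :
  exists psi : A, exists E : 'I_n -> V, exists delta : R,
  exists gamma : 'rV[R]_n -> R -> M,
  [/\ 0 < delta, forall X : V, exists a, psi ^+ 3 *: X = \sum_i a i *: E i,
      forall u, gamma u 0 = p,
      forall u t, `|u| < delta -> `|t| < 2 -> 0 < psi (gamma u t) /\
        forall f : A, is_derive t 1 (fun s => f (gamma u s))
          ((\sum_i u 0 i * (E i f : A) (gamma u t)) / psi (gamma u t)) &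
      nbhs p [set gamma u 1 | u in [set u | `|u| < delta]]].
Proof.
have [c ac cp] := atlas_cover p.
set x0 := chart_map c p.
have Wx0 : (chart_map c @` chart_dom c) x0 by exists p.
have [D [K [chi [[oD DW convD] cK KD schi [chi_ge0 chi0 chix0]]]]] :=
  smooth_bump (chart_img_open c) Wx0.
have {}schi : smooth_on D chi by exact: schi.
have Dx0 : D x0.
  apply: KD; have [//|/chi0 E] := pselect (K x0).
  by rewrite E ltxx in chix0.
have near_x0 : \forall y \near x0, D y /\ 0 < chi y.
  near=> y; split; first by near: y; exact: open_nbhs_nbhs.
  near: y; have /cvgr_gt := Ck_on_continuous (schi 0%N) Dx0; exact.
have /nbhs_ballP[d /= d0 dH] := near_x0.
pose psi := frame_weight ac oD DW cK KD schi chi0.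
pose gamma (u : 'rV[R]_n) (t : R) : M := chart_inv c (x0 + t *: u).
have in_d (u : 'rV[R]_n) (t : R) : `|u| < d / 2 -> `|t| < 2 ->
    D (x0 + t *: u) /\ 0 < chi (x0 + t *: u).
  move=> ud t2; apply: dH; rewrite -ball_normE /= opprD addrA subrr sub0r normrN.
  rewrite normrZ (_ : d = 2 * (d / 2)); last by field.
  apply: (@le_lt_trans _ _ (2 * `|u|)); last by rewrite ltr_pM2l.
  by rewrite ler_wpM2r // ltW.
exists psi, (frame ac oD DW cK KD schi chi0), (d / 2), gamma; split.
- by rewrite divr_gt0.
- exact: frame_expansion.
- by move=> u; rewrite /gamma scale0r addr0 chart_mapK.
- move=> u t ud t2; have [Dy chiy] := in_d u t ud t2.
  have [q cq qy] := DW _ Dy.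
  have gq : gamma u t = q by rewrite /gamma -qy chart_mapK.
  have cut w (sw : smooth_on D w) :
      cutoff ac oD DW cK KD schi chi0 sw (gamma u t) = chi (x0 + t *: u) * w (x0 + t *: u).
    by rewrite gq /= /ext_by_zero asboolT // qy.
  have psiE : psi (gamma u t) = chi (x0 + t *: u) by rewrite [LHS]cut /cst mulr1.
  split=> [|f]; first by rewrite psiE.
  have sf := smoothFun_smooth_on f ac.
  have df : differentiable (f \o chart_inv c) (x0 + t *: u).
    by apply: (C1_differentiable (chart_img_open c) _ (sf 1%N)); have := DW _ Dy.
  have := is_derive_line (diff_derivable (v := u) df).
  move=> /is_derive_eq; apply; rewrite psiE derive_sum_partials //.
  apply: (@mulIf _ (chi (x0 + t *: u))); first by rewrite gt_eqF.
  rewrite divfK ?gt_eqF // mulr_suml; apply: eq_bigr => i _.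
  by rewrite [X in _ = _ * X]cut mulrAC mulrA.
- have nW : nbhs p (chart_dom c) by apply: open_nbhs_nbhs; split=> //; exact: chart_dom_open.
  have d20 : 0 < d / 2 by rewrite divr_gt0.
  have nB : nbhs p (chart_map c @^-1` ball x0 (d / 2)).
    by apply: (chart_map_continuous cp); exact: nbhsx_ballx.
  apply: filterS (filterI nW nB) => q [cq] /=; rewrite -ball_normE /= => Bq.
  exists (chart_map c q - x0) => /=; first by rewrite distrC.
  by rewrite /gamma scale1r addrC subrK chart_mapK.
Unshelve. all: by end_near. Qed.

(** Along a chart segment this is the one-variable test. A general [X] is compared with the constant
    combination of the [E i] that agrees with [psi ^+ 3 *: X] at [p]: the derivatives of the
    coefficients only multiply [E i b], which vanishes at [p]. *)
Lemma vf_at_max (b : A) (p : M) : (forall q, b q <= b p) ->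
  (forall X : V, (X b : A) p = 0) /\ (forall X : V, (X (X b) : A) p <= 0).
Proof.
move=> bmax; have [psi [E [d [gamma [d0 frm g0 g1 _]]]]] := local_frame p.
pose W (u : 'rV[R]_n) : V := \sum_i (u 0 i *: (1 : A)) *: E i.
have WE u (f : A) q : (W u f : A) q = \sum_i u 0 i * (E i f : A) q.
  by rewrite vf_sumE; apply: eq_bigr => i _; rewrite -[X in X * _]/(_ * 1) mulr1.
have small u : `|u| < d -> (W u b : A) p = 0 /\ (W u (W u b) : A) p <= 0.
  move=> ud.
  have dW : is_derive (0 : R) 1 (fun s => (W u b : A) (gamma u s))
      ((W u (W u b) : A) p / psi p).
    have [|_ H] := g1 u 0 ud; first by rewrite normr0.
    by have := H (W u b); rewrite -WE g0.
  have two0 : 0 < (2 : R) by [].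
  have psip : 0 < psi p by have [|+ _] := g1 u 0 ud; rewrite ?normr0 // g0.
  have [|||w0 w1] := @second_derivative_at_max R (fun s => b (gamma u s))
    (fun s => (W u b : A) (gamma u s)) (fun s => psi (gamma u s)) _ _ two0 _ _ _ dW.
  - by move=> t t2; have [_ H] := g1 u t ud t2; rewrite WE.
  - by move=> t t2; have [] := g1 u t ud t2.
  - by move=> t; rewrite g0.
  by split; [rewrite g0 in w0|rewrite pmulr_lle0 ?invr_gt0 in w1].
have psip : 0 < psi p.
  by have [||+ _] := g1 0 0; rewrite ?normr0 // g0.
(* Segments exist only for short [u]; the conditions being homogeneous of degrees 1 and 2 in [u],
   rescaling gives all [u]. *)
have scale (u : 'rV[R]_n) : exists2 e : R, 0 < e & `|e *: u| < d.
  exists (d / (`|u| + 1)); first by rewrite divr_gt0 // ltr_wpDl.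
  rewrite normrZ gtr0_norm; last by rewrite divr_gt0 // ltr_wpDl.
  by rewrite mulrAC ltr_pdivrMr ?ltr_wpDl // ltr_pM2l // ltrDl.
have WZ e u (f : A) : (W (e *: u) f : A) = e *: (W u f : A).
  apply: smoothFunP => q; rewrite WE -[RHS]/(e * (W u f : A) q) WE mulr_sumr.
  by apply: eq_bigr => i _; rewrite mxE mulrA.
have W1 u : (W u b : A) p = 0.
  have [e e0 /small[H _]] := scale u; move: H; rewrite WZ => /eqP.
  by rewrite -[X in X == _]/(e * (W u b : A) p) mulf_eq0 (gt_eqF e0) => /eqP.
have W2 u : (W u (W u b) : A) p <= 0.
  have [e e0 /small[_ H]] := scale u; move: H; rewrite !WZ vfZ.
  by rewrite -[X in X <= _]/(e * (e * (W u (W u b) : A) p)) !pmulr_rle0.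
have psi30 : psi p ^+ 3 != 0 by rewrite expf_neq0 // gt_eqF.
have main (X : V) : exists u, forall f : A, psi p ^+ 3 * (X f : A) p = (W u f : A) p.
  have [a aE] := frm X; exists (\row_i a i p) => f.
  rewrite WE -[LHS]/(((psi ^+ 3 *: X) f : A) p) aE vf_sumE.
  by apply: eq_bigr => i _; rewrite mxE.
have Eb i : (E i b : A) p = 0.
  rewrite -(W1 (delta_mx 0 i)) WE (bigD1 i) //= mxE !eqxx mul1r big1 ?addr0 //.
  by move=> j ji; rewrite mxE eqxx /= (negbTE ji) mul0r.
have X1 (X : V) : (X b : A) p = 0.
  have [u uE] := main X; apply: (mulfI psi30); rewrite mulr0 uE; exact: W1.
split=> // X.
have [a aE] := frm X; pose u : 'rV[R]_n := \row_i a i p.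
have uE (f : A) : psi p ^+ 3 * (X f : A) p = (W u f : A) p.
  rewrite WE -[LHS]/(((psi ^+ 3 *: X) f : A) p) aE vf_sumE.
  by apply: eq_bigr => i _; rewrite mxE.
have e1 : psi p ^+ 3 * (X (psi ^+ 3 * (X b : A)) : A) p = (W u (W u b) : A) p.
  rewrite uE.
  have -> : psi ^+ 3 * (X b : A) = \sum_i a i * (E i b : A).
    rewrite -[LHS]/((psi ^+ 3 *: X) b : A) aE; apply: smoothFunP => q.
    by rewrite vf_sumE smoothFun_sumE.
  have -> : (W u b : A) = \sum_i u 0 i *: (E i b : A).
    by apply: smoothFunP => q; rewrite WE smoothFun_sumE.
  rewrite !vf_sum !smoothFun_sumE; apply: eq_bigr => i _.
  rewrite vfM vfZ.
  rewrite -[LHS]/(a i p * (W u (E i b) : A) p + (E i b : A) p * (W u (a i) : A) p).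
  by rewrite Eb mul0r addr0 -[RHS]/(u 0 i * (W u (E i b) : A) p) mxE.
move: e1; rewrite vfM.
rewrite -[X in _ * X]/(psi p ^+ 3 * (X (X b) : A) p + (X b : A) p * (X (psi ^+ 3) : A) p).
rewrite X1 mul0r addr0 mulrA => e1.
have := W2 u; rewrite -e1 pmulr_rle0 // mulr_gt0 // exprn_gt0 //.
Qed.

End LocalFrames.

(** * Parallel symmetric forms *)

Section ParallelSymmetricForms.
Context {R : realType} (M : manifold R).
Local Notation n := (Defs.dim M).
Local Notation A := 'C^oo(M).
Local Notation V := (vectorField M).
Variable nabla : V -> V -> V.

Record parallel_symmetric (h : V -> V -> A) : Prop := {
  parallel_linear : forall (f : A) X Y Z, h (f *: X + Y) Z = f * h X Z + h Y Z;
  parallel_sym : forall X Y, h X Y = h Y X;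
  parallel_eq : forall X Y Z : V,
    X (h Y Z) = h (nabla X Y) Z + h Y (nabla X Z) }.

Section OneForm.
Variable h : V -> V -> A.
Hypothesis ph : parallel_symmetric h.

Let h0 Z : h 0 Z = 0.
Proof.
have := parallel_linear ph 0 0 0 Z; rewrite scale0r addr0 mul0r add0r => H.
have := parallel_linear ph 1 0 0 Z; rewrite scale1r addr0 mul1r => H1.
by apply: (@addrI _ (h 0 Z)); rewrite -H1 addr0.
Qed.

Let hZl f X Z : h (f *: X) Z = f * h X Z.
Proof. by have := parallel_linear ph f X 0 Z; rewrite h0 !addr0. Qed.

Let hZr f X Z : h X (f *: Z) = f * h X Z.
Proof. by rewrite parallel_sym // hZl [h Z X]parallel_sym. Qed.

Let h_suml m (a : 'I_m -> A) (E : 'I_m -> V) Z :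
  h (\sum_i a i *: E i) Z = \sum_i a i * h (E i) Z.
Proof.
elim: (index_enum _) => [|i r IH]; first by rewrite !big_nil h0.
by rewrite !big_cons parallel_linear // IH.
Qed.

Let h_sumr m (a : 'I_m -> A) (E : 'I_m -> V) Z :
  h Z (\sum_i a i *: E i) = \sum_i a i * h Z (E i).
Proof.
rewrite parallel_sym // h_suml; apply: eq_bigr => i _.
by rewrite [h (E i) Z]parallel_sym.
Qed.

Let h_sum2 m (a b : 'I_m -> A) (E : 'I_m -> V) q :
  h (\sum_i a i *: E i) (\sum_i b i *: E i) q =
  \sum_i \sum_j a i q * h (E i) (E j) q * b j q.
Proof.
rewrite h_suml smoothFun_sumE; apply: eq_bigr => i _.
rewrite h_sumr -[LHS]/(a i q * (\sum_j b j * h (E i) (E j)) q) smoothFun_sumE.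
rewrite mulr_sumr; apply: eq_bigr => j _.
by rewrite -[X in _ * X]/(b j q * h (E i) (E j) q); ring.
Qed.

(** The Gram matrix of [h] in the frame along [gamma u] solves the equation of [psd_linear_ode],
    which carries semidefiniteness from t = 0 to t = 1; the endpoints [gamma u 1] fill a
    neighbourhood of [p]. *)
Lemma psd_near p : (forall X, 0 <= h X X p) -> \forall q \near p, forall X, 0 <= h X X q.
Proof.
move=> hp; have [psi [E [d [gamma [d0 frm g0 g1 gN]]]]] := local_frame p.
apply: filterS gN => _ [u /= ud <-].
have [a aE] : exists a : 'I_n -> 'I_n -> 'I_n -> A, forall k i,
    psi ^+ 3 *: nabla (E k) (E i) = \sum_l a k i l *: E l.
  have /choice[a aP] : forall ki : 'I_n * 'I_n, exists a : 'I_n -> A,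
      psi ^+ 3 *: nabla (E ki.1) (E ki.2) = \sum_l a l *: E l.
    by move=> ki; exact: frm.
  by exists (fun k i => a (k, i)) => k i; exact: (aP (k, i)).
have I2 t : unit_segment R t -> `|t| < 2.
  rewrite /= in_itv /= => /andP[t0 t1]; rewrite ger0_norm //.
  by rewrite (le_lt_trans t1) // ltr1n.
pose H t := \matrix_(i < n, j < n) h (E i) (E j) (gamma u t).
(* The connection matrix along the segment: three powers of [psi] come from expanding
   [nabla (E k) (E i)] in the frame, the fourth from the velocity, which is \sum_k u_k E_k divided
   by [psi]. *)
pose G t := \matrix_(i < n, l < n)
  ((\sum_k u 0 k * a k i l (gamma u t)) / psi (gamma u t) ^+ 4).
have conv (t : R) : `|t| < 2 -> forall k i j, h (nabla (E k) (E i)) (E j) (gamma u t) =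
    \sum_l a k i l (gamma u t) / psi (gamma u t) ^+ 3 * H t l j.
  move=> t2 k i j; have [psi0 _] := g1 u t ud t2.
  have p3 : psi (gamma u t) ^+ 3 != 0 by rewrite expf_neq0 // gt_eqF.
  apply: (mulfI p3); rewrite mulr_sumr.
  rewrite -[LHS]/((psi ^+ 3 * h (nabla (E k) (E i)) (E j)) (gamma u t)).
  rewrite -hZl aE h_suml smoothFun_sumE; apply: eq_bigr => l _.
  rewrite !mxE -[LHS]/(a k i l (gamma u t) * h (E l) (E j) (gamma u t)).
  by field; rewrite gt_eqF.
have Hs t : (H t)^T = H t by apply/matrixP => i j; rewrite !mxE parallel_sym.
have dH t : unit_segment R t -> forall i j,
    is_derive t 1 (fun s : R => H s i j) ((G t *m H t + H t *m (G t)^T) i j).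
  move=> /I2 t2 i j; have [psi0 D] := g1 u t ud t2.
  have -> : (fun s : R => H s i j) = (fun s : R => h (E i) (E j) (gamma u s)).
    by apply/funext => s; rewrite mxE.
  apply: is_derive_eq (D (h (E i) (E j))) _.
  rewrite !mxE mulr_suml.
  under eq_bigr => k _.
    rewrite parallel_eq //.
    rewrite -[X in _ * X / _]/(h (nabla (E k) (E i)) (E j) (gamma u t) +
      h (E i) (nabla (E k) (E j)) (gamma u t)) [h (E i) _]parallel_sym //.
    rewrite !conv // mulrDr mulrDl !mulr_sumr !mulr_suml.
    over.
  rewrite big_split /= exchange_big /= [X in _ + X]exchange_big /=.
  congr (_ + _); apply: eq_bigr => l _; rewrite !mxE.
    rewrite -mulrA mulr_suml; apply: eq_bigr => k _.
    by field; rewrite gt_eqF.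
  rewrite mulrC -mulrA mulr_suml; apply: eq_bigr => k _.
  by rewrite [h (E i) _]parallel_sym //; field; rewrite gt_eqF.
have cf (f : A) (t : R) : `|t| < 2 -> {for t, continuous (fun s : R => f (gamma u s))}.
  move=> t2; have [_ D] := g1 u t ud t2.
  by apply: differentiable_continuous; apply/derivable1_diffP; case: (D f).
have cG i l (t : R) : `|t| < 2 -> {for t, continuous (fun s : R => G s i l)}.
  move=> t2; have -> : (fun s : R => G s i l) = fun s : R =>
    (\sum_k u 0 k * a k i l (gamma u s)) * ((psi ^+ 4) (gamma u s))^-1.
    by apply/funext => s; rewrite mxE.
  apply: continuousM.
    apply: continuous_sum_at => k; apply: continuousM; first exact: cst_continuous.
    exact: cf.
  apply: continuousV; last exact: cf.
  have [psi0 _] := g1 u t ud t2.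
  by rewrite -[_ (gamma u t)]/(psi (gamma u t) ^+ 4) expf_neq0 // gt_eqF.
(* The maximum over [0, 1] of the sum of all entries in absolute value serves as the uniform bound
   on [G]. *)
have [|c cI Hc] := @EVT_max R (fun t => \sum_i \sum_l `|G t i l|) 0 1 ler01.
  apply: continuous_in_subspaceT => t; rewrite inE => /I2 t2.
  apply: continuous_sum_at => i; apply: continuous_sum_at => l.
  apply: (@continuous_comp _ _ _ (fun s : R => G s i l) (fun x : R => `|x|)); first exact: cG.
  exact: norm_continuous.
have GC t : unit_segment R t -> forall i j,
    `|G t i j| <= \sum_i \sum_l `|G c i l|.
  move=> It i j; apply: le_trans (Hc t It).
  rewrite (bigD1 i) //= (bigD1 j) //= -addrA lerDl addr_ge0 ?sumr_ge0 // => k _.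
  by rewrite sumr_ge0.
have H0 x : 0 <= mxform (H 0) x x.
  have := hp (\sum_i (x 0 i *: (1 : A)) *: E i); rewrite h_sum2 mxformE.
  congr (0 <= _); apply: eq_bigr => i _; apply: eq_bigr => j _.
  rewrite mxE g0 -[X in X * _ * _]/(x 0 i * 1) -[X in _ * X]/(x 0 j * 1).
  by rewrite !mulr1.
have H1 := psd_linear_ode (fun t _ => Hs t) dH GC H0.
(* The frame only sees [psi ^+ 3 *: X]; the factor psi^6 in [h] is positive and can be divided
   out. *)
move=> X; have [b bE] := frm X.
have [|psi0 _] := g1 u 1 ud; first by rewrite normr1 ltr1n.
have := H1 (\row_i b i (gamma u 1)).
have -> : mxform (H 1) (\row_i b i (gamma u 1)) (\row_i b i (gamma u 1)) =
    h (psi ^+ 3 *: X) (psi ^+ 3 *: X) (gamma u 1).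
  rewrite bE h_sum2 mxformE; apply: eq_bigr => i _; apply: eq_bigr => j _.
  by rewrite !mxE.
rewrite hZl hZr.
rewrite -[X in _ <= X]/(psi (gamma u 1) ^+ 3 *
  (psi (gamma u 1) ^+ 3 * h X X (gamma u 1))).
by rewrite !pmulr_rge0 ?exprn_gt0.
Qed.

(** The set of points where [h] is semidefinite is open by [psd_near] and closed by continuity. *)
Lemma psd_connected p : connected [set: M] -> (forall X, 0 <= h X X p) ->
  forall q X, 0 <= h X X q.
Proof.
move=> cM hp q; pose F : set M := [set q | forall X, 0 <= h X X q].
suff FT : F = setT by have : F q by rewrite FT.
apply: cM; first by exists p.
  exists F; last by rewrite setTI.
  by rewrite openE => x Fx; exact: psd_near.
exists F; last by rewrite setTI.
rewrite (_ : F = \bigcap_(X in [set: V]) ((h X X : M -> R) @^-1` [set t | 0 <= t])).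
  apply: closed_bigI => X _; apply: closed_comp; last exact: closed_ge.
  by move=> x _; exact: smoothFun_continuous.
by apply/seteqP; split=> [x Fx X _|x Fx X]; [exact: Fx|exact: (Fx X)].
Qed.

End OneForm.

Lemma parallel_symmetricN h : parallel_symmetric h ->
  parallel_symmetric (fun X Y => - h X Y).
Proof.
move=> ph; split=> [f X Y Z|X Y|X Y Z].
- by rewrite parallel_linear // opprD mulrN.
- by rewrite parallel_sym.
- by rewrite vfN parallel_eq // opprD.
Qed.

(** The hypothesis on [h X X] is a Hessian-like expression written without a connection: the
    first-order term [W b] vanishes at critical points of [b], and the second-order terms have the
    sign dictated by the extremum. Polarisation passes from [h X X] to [h X Y]. *)
Lemma parallel_hessian_eq0 h (b : A) : compact [set: M] -> connected [set: M] ->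
  parallel_symmetric h ->
  (forall X, exists Y Z W : V,
     h X X = (2^-1 : R) *: ((Y (Y b) : A) + (Z (Z b) : A) + (W b : A))) ->
  forall X Y, h X Y = 0.
Proof.
move=> kM cM ph hb.
suff hXX X q : h X X q = 0.
  move=> X Y; apply: smoothFunP => q; have := hXX (1 *: X + Y) q.
  rewrite parallel_linear // mul1r [h X _]parallel_sym // [h Y _]parallel_sym //.
  rewrite !(parallel_linear ph 1) !mul1r [h Y X]parallel_sym //.
  rewrite -[LHS]/((h X X q + h X Y q) + (h X Y q + h Y Y q)) !hXX.
  rewrite add0r addr0 -mulr2n => /eqP; rewrite mulrn_eq0 /= => /eqP ->.
  by [].
have M0 : [set: M] !=set0 by exists q.
have cb : {within [set: M], continuous (b : M -> R)}.
  by apply: continuous_subspaceT; exact: smoothFun_continuous.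
have hE Y Z W p : ((2^-1 : R) *: ((Y (Y b) : A) + (Z (Z b) : A) + (W b : A)) : A) p =
  2^-1 * ((Y (Y b) : A) p + (Z (Z b) : A) p + (W b : A) p) by [].
have [p _ pmax] := compact_EVT_max M0 kM cb.
have [p' _ pmin] := compact_EVT_min M0 kM cb.
apply/eqP; rewrite eq_le; apply/andP; split.
  rewrite -oppr_ge0.
  apply: (psd_connected (parallel_symmetricN ph) (p := p)) => // {}X.
  have [X1 X2] := @vf_at_max R M b p (fun q => pmax q (mem_set I)).
  have [Y [Z [W E]]] := hb X.
  rewrite -[X in _ <= X]/(- (h X X p)) E hE X1 addr0 oppr_ge0.
  by rewrite pmulr_rle0 // -[leRHS](addr0 0); apply: lerD.
apply: (psd_connected ph (p := p')) => // {}X.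
have [|X1 X2] := @vf_at_max R M (- b) p'.
  by move=> q'; rewrite lerN2; exact: pmin (mem_set I).
have [Y [Z [W E]]] := hb X.
have W0 : (W b : A) p' = 0.
  by apply/eqP; rewrite -oppr_eq0; have := X1 W; rewrite vfN => /eqP.
have XX (T : V) : 0 <= (T (T b) : A) p'.
  by rewrite -oppr_le0; have := X2 T; rewrite !vfN.
by rewrite E hE W0 addr0 pmulr_rge0 // addr_ge0.
Qed.

End ParallelSymmetricForms.

(** * Complex forms of degree at most 2 *)

Lemma sum_set_ord1 (V : nmodType) (F : {set 'I_1} -> V) :
  \sum_T F T = F finset.set0 + F [set: 'I_1]%SET.
Proof.
have n0 : ([set: 'I_1]%SET) != finset.set0.
  by apply/eqP => /finset.setP/(_ ord0); rewrite !inE.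
rewrite (bigD1 finset.set0) //= (bigD1 [set: 'I_1]%SET) //= big1 ?addr0 //.
move=> T /andP[T0 TT].
have [i iT] := finset.set0Pn _ T0; case/negP: TT; apply/eqP/finset.setP => j.
by rewrite inE !ord1 in iT *.
Qed.

Lemma ord2P (i : 'I_2) : i = ord0 \/ i = ord_max.
Proof. by case: i => [[|[|//]] Hi]; [left|right]; exact: val_inj. Qed.

Lemma set_ord2P (T : {set 'I_2}) :
  [\/ T = finset.set0, T = [set ord0]%SET, T = [set ord_max]%SET | T = [set: 'I_2]%SET].
Proof.
have E (S : {set 'I_2}) : (ord0 \in T) = (ord0 \in S) ->
    (ord_max \in T) = (ord_max \in S) -> T = S.
  by move=> e0 e1; apply/finset.setP => i; have [->|->] := ord2P i.
case E0 : (ord0 \in T); case E1 : (ord_max \in T).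
- by constructor 4; apply: E; rewrite inE ?E0 ?E1.
- by constructor 2; apply: E; rewrite inE ?E0 ?E1.
- by constructor 3; apply: E; rewrite inE ?E0 ?E1.
- by constructor 1; apply: E; rewrite inE ?E0 ?E1.
Qed.

Lemma sum_set_ord2 (V : nmodType) (F : {set 'I_2} -> V) :
  \sum_T F T = F finset.set0 + F [set ord0]%SET + F [set ord_max]%SET +
    F [set: 'I_2]%SET.
Proof.
have N (S T : {set 'I_2}) i : (i \in S) != (i \in T) -> S != T.
  by move=> h; apply: contraNneq h => ->.
rewrite (bigD1 finset.set0) //= (bigD1 [set ord0]%SET) //=; last first.
  by apply: (N _ _ ord0); rewrite !inE.
rewrite (bigD1 [set ord_max]%SET) //=; last first.
  by apply/andP; split; apply: (N _ _ ord_max); rewrite !inE.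
rewrite (bigD1 [set: 'I_2]%SET) //=; last first.
  by rewrite -andbA; apply/and3P; split;
    [apply: (N _ _ ord0)|apply: (N _ _ ord_max)|apply: (N _ _ ord0)]; rewrite !inE.
rewrite big1 ?addr0 ?addrA // => T.
by case: (set_ord2P T) => ->; rewrite eqxx ?andbF.
Qed.

Section LowDegreeForms.
Context {R : realType} (M : manifold R).
Local Notation A := 'C^oo(M).
Local Notation V := (vectorField M).
Implicit Types (a b : V -> A) (B C : V -> V -> A).

Lemma sfD (f k : A) p : (f + k) p = f p + k p. Proof. by []. Qed.
Lemma sfM (f k : A) p : (f * k) p = f p * k p. Proof. by []. Qed.
Lemma sfN (f : A) p : (- f) p = - f p. Proof. by []. Qed.
Lemma sfZ (r : R) (f : A) p : (r *: f) p = r * f p. Proof. by []. Qed.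
Lemma sf0 p : (0 : A) p = 0. Proof. by []. Qed.
Lemma sf1 p : (1 : A) p = 1. Proof. by []. Qed.
Lemma half_at p : Defs.half M p = 2^-1. Proof. by rewrite -[LHS]/(2^-1 * 1) mulr1. Qed.
Lemma sfZo (f : A) (k : A^o) p : (f *: k : A) p = f p * (k : A) p.
Proof. by []. Qed.
(** Evaluation at a point, which reduces identities in C^oo(M) to identities in R within reach of
    [ring], [field] and [lra]. *)
Definition smoothFunE := (sfD, sfM, sfN, sfZ, sfZo, sf0, sf1, half_at).

Lemma pairD (f f' k k' : A) :
  ((f, f') : smoothFunC M) + (k, k') = (f + k, f' + k').
Proof. by []. Qed.
Lemma pairN (f f' : A) : - ((f, f') : smoothFunC M) = (- f, - f').
Proof. by []. Qed.
Lemma pairZ (s f f' : A) : s *: ((f, f') : smoothFunC M) = (s * f, s * f').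
Proof. by []. Qed.
Lemma pair0 : (0 : smoothFunC M) = (0, 0). Proof. by []. Qed.

Definition Clinear a := forall (f : A) x y, a (f *: x + y) = f * a x + a y.

Record Cbilinear B : Prop := {
  Cbilinearl : forall (f : A) x y z, B (f *: x + y) z = f * B x z + B y z;
  Cbilinearr : forall (f : A) x y z, B z (f *: x + y) = f * B z x + B z y }.

Section Linear1.
Variable a : V -> A.
Hypothesis la : Clinear a.
Lemma Clinear0 : a 0 = 0.
Proof.
have := la 1 0 0; rewrite scale1r addr0 mul1r => H.
by apply: (@addrI _ (a 0)); rewrite -H addr0.
Qed.
Lemma ClinearD x y : a (x + y) = a x + a y.
Proof. by have := la 1 x y; rewrite scale1r mul1r. Qed.
Lemma ClinearZ f x : a (f *: x) = f * a x.
Proof. by have := la f x 0; rewrite Clinear0 !addr0. Qed.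
Lemma ClinearN x : a (- x) = - a x.
Proof. by rewrite -scaleN1r ClinearZ mulN1r. Qed.
Lemma ClinearB x y : a (x - y) = a x - a y.
Proof. by rewrite ClinearD ClinearN. Qed.
End Linear1.

Section Bilinear.
Variable B : V -> V -> A.
Hypothesis bB : Cbilinear B.
Let ll z : Clinear (B ^~ z). Proof. by move=> f x y; rewrite (Cbilinearl bB). Qed.
Let lr z : Clinear (B z). Proof. by move=> f x y; rewrite (Cbilinearr bB). Qed.
Lemma CbilinearZl f x y : B (f *: x) y = f * B x y. Proof. exact: (ClinearZ (ll y)). Qed.
Lemma CbilinearZr f x y : B x (f *: y) = f * B x y. Proof. exact: (ClinearZ (lr x)). Qed.
Lemma CbilinearNl x y : B (- x) y = - B x y. Proof. exact: (ClinearN (ll y)). Qed.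
Lemma CbilinearNr x y : B x (- y) = - B x y. Proof. exact: (ClinearN (lr x)). Qed.
Lemma CbilinearDl x y z : B (x + y) z = B x z + B y z. Proof. exact: (ClinearD (ll z)). Qed.
Lemma CbilinearDr x y z : B z (x + y) = B z x + B z y. Proof. exact: (ClinearD (lr z)). Qed.
Lemma CbilinearBl x y z : B (x - y) z = B x z - B y z. Proof. exact: (ClinearB (ll z)). Qed.
Lemma CbilinearBr x y z : B z (x - y) = B z x - B z y. Proof. exact: (ClinearB (lr z)). Qed.
End Bilinear.

Definition cform1 a b : cform M 1 := fun X => (a (X ord0), b (X ord0)).
Definition cform2 B C : cform M 2 :=
  fun X => (B (X ord0) (X ord_max), C (X ord0) (X ord_max)).

(** Exterior derivatives of real forms with the arguments listed separately instead of as a tuple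
    indexed by ['I_k]; complex forms are then handled as pairs of real ones. *)
Definition dform1 a (x y : V) : A := x (a y) - y (a x) - a (lie_bracket x y).
Definition dform2 B (x y z : V) : A :=
  x (B y z) - y (B x z) + z (B x y)
  - B (lie_bracket x y) z - B y (lie_bracket x z) + B x (lie_bracket y z).

Lemma big_ord1_cond (U : nmodType) (P : pred 'I_1) (F : 'I_1 -> U) :
  \sum_(l < 1 | P l) F l = if P ord0 then F ord0 else 0.
Proof. by rewrite big_mkcond big_ord1. Qed.

Lemma dform_cform1 a b : dform (cform1 a b) = cform2 (dform1 a) (dform1 b).
Proof.
apply/funext => X; rewrite /dform big_ord_recl big_ord1.
rewrite !big_ord1_cond /= /cform1 /cform2 /= /set_arg !eqxx /=.
have -> : lift (lift ord0 (ord0 : 'I_1)) ord0 = ord0 :> 'I_2 by exact: val_inj.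
have -> : lift ord0 (ord0 : 'I_1) = ord_max by exact: val_inj.
rewrite /vf_actC /bump /= addn0 expr0 expr1 subr0.
rewrite !(pairN, pairD, pairZ) /= /dform1.
by congr pair; apply: smoothFunP => p; rewrite !smoothFunE; ring.
Qed.

Lemma dform_cform2 B C : (forall x y z, dform2 B x y z = 0) ->
  (forall x y z, dform2 C x y z = 0) -> dform (cform2 B C) = 0.
Proof.
move=> dB dC; apply/funext => X; rewrite /dform !big_ord_recl big_ord0 /=.
rewrite !big_mkcond !big_ord_recl !big_ord0 /=.
set i0 : 'I_3 := ord0; set i1 : 'I_3 := lift ord0 ord0.
set i2 : 'I_3 := lift ord0 (lift ord0 ord0).
rewrite /cform2 /set_arg /vf_actC /=.
have e (i j : 'I_3) : (i : nat) = j -> i = j by exact: val_inj.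
have -> : lift i0 (ord0 : 'I_2) = i1 by exact: e.
have -> : lift i0 (ord_max : 'I_2) = i2 by exact: e.
have -> : lift i1 (ord0 : 'I_2) = i0 by exact: e.
have -> : lift i1 (ord_max : 'I_2) = i2 by exact: e.
have -> : lift i2 (ord0 : 'I_2) = i0 by exact: e.
have -> : lift i2 (ord_max : 'I_2) = i1 by exact: e.
have -> : lift i1 (lift ord0 ord0 : 'I_2) = i2 by exact: e.
have E2 : (fun l : 'I_2 => (bump 0 (bump 0 0) <= l)%N) =1 xpred0.
  by move=> l; rewrite /bump /= leqNgt ltn_ord.
rewrite (eq_bigl _ _ E2) big_pred0_eq.
rewrite /bump /= !addn0 expr0 expr1 sqrrN expr1n !addr0 !add0r.
rewrite !(pairN, pairD, pairZ, pair0) /=.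
rewrite -[RHS]/((0, 0) : smoothFunC M).
have dBp p := congr1 (fun f : A => f p) (dB (X i0) (X i1) (X i2)).
have dCp p := congr1 (fun f : A => f p) (dC (X i0) (X i1) (X i2)).
congr pair; apply: smoothFunP => p; rewrite !smoothFunE.
- by have := dBp p; rewrite /dform2 !smoothFunE => E; rewrite subr0 -[RHS]E; ring.
- by have := dCp p; rewrite /dform2 !smoothFunE => E; rewrite subr0 -[RHS]E; ring.
Qed.

End LowDegreeForms.

Section TypeDecomposition.
Context {R : realType} (M : manifold R) (J : {linear vectorField M -> vectorField M}).
Local Notation A := 'C^oo(M).
Local Notation V := (vectorField M).
Implicit Types (a b : V -> A) (B C : V -> V -> A).

(* The parts of [x] of types (1,0) and (0,1) are [(x - s i J x) / 2] with [s] the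
   value of [type_sign] at [true] and [false]. *)
Definition type_sign (c : bool) : R := if c then 1 else -1.

Lemma type_part_cform1 (S : {set 'I_1}) a b X : Clinear a -> Clinear b ->
  type_part J S (cform1 a b) X =
    ((2^-1 : R) *: (a (X ord0) + type_sign (ord0 \in S) *: b (J (X ord0))),
     (2^-1 : R) *: (b (X ord0) - type_sign (ord0 \in S) *: a (J (X ord0)))).
Proof.
move=> la lb; rewrite /type_part /cextend sum_set_ord1 cards0 cardsT card_ord /=.
rewrite /cform1 !inE /mul_i /= /part10 /part01 pairD.
case: ifP => _; congr pair; apply: smoothFunP => p;
  rewrite ?(ClinearN la) ?(ClinearN lb) ?(ClinearZ la) ?(ClinearZ lb)
    !smoothFunE /type_sign; ring.
Qed.

Lemma type_part_cform2 (S : {set 'I_2}) B C X : Cbilinear B -> Cbilinear C ->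
  let x := X ord0 in let y := X ord_max in
  let s := type_sign (ord0 \in S) in let t := type_sign (ord_max \in S) in
  type_part J S (cform2 B C) X =
    ((4^-1 : R) *: (B x y - (s * t) *: B (J x) (J y) + s *: C (J x) y + t *: C x (J y)),
     (4^-1 : R) *: (C x y - (s * t) *: C (J x) (J y) - s *: B (J x) y - t *: B x (J y))).
Proof.
move=> bB bC x y s t.
rewrite /type_part /cextend sum_set_ord2 cards0 !cards1 cardsT card_ord /=.
rewrite /cform2 !inE /mul_i /= -/x -/y /s /t /part10 /part01 !pairD.
have i4 : (4^-1 : R) = 2^-1 * 2^-1 by rewrite -invfM -natrM.
by case: (ord0 \in S); case: (ord_max \in S); congr pair; apply: smoothFunP => p;
  rewrite ?(CbilinearNl bB) ?(CbilinearNl bC) ?(CbilinearNr bB) ?(CbilinearNr bC);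
  rewrite ?(CbilinearZl bB) ?(CbilinearZl bC) ?(CbilinearZr bB) ?(CbilinearZr bC);
  rewrite ?(CbilinearNl bB) ?(CbilinearNl bC) ?(CbilinearNr bB) ?(CbilinearNr bC);
  rewrite ?(CbilinearZl bB) ?(CbilinearZl bC) ?(CbilinearZr bB) ?(CbilinearZr bC)
  !smoothFunE i4 /type_sign; ring.
Qed.

End TypeDecomposition.

(** * Types of forms and the operators del and delbar in low degree *)

Section Bidegrees.
Context {R : realType} (M : manifold R) (J : {linear vectorField M -> vectorField M}).
Hypothesis JJ : forall X, J (J X) = - X.
Local Notation A := 'C^oo(M).
Local Notation V := (vectorField M).
Implicit Types (a b : V -> A) (B C : V -> V -> A).

Lemma component_cform1 a b : Clinear a -> Clinear b ->
  component J 0 (cform1 a b) =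
    cform1 (fun x => (2^-1 : R) *: (a x - b (J x))) (fun x => (2^-1 : R) *: (b x + a (J x))).
Proof.
move=> la lb; apply/funext => X; rewrite /component fct_sumE big_mkcond sum_set_ord1.
rewrite cards0 cardsT card_ord /= addr0 type_part_cform1 // !inE /type_sign /cform1.
by congr pair; apply: smoothFunP => p; rewrite !smoothFunE; ring.
Qed.

Lemma component_cform2_2 B C : Cbilinear B -> Cbilinear C ->
  component J 2 (cform2 B C) =
    cform2 (fun x y => (4^-1 : R) *: (B x y - B (J x) (J y) + C (J x) y + C x (J y)))
        (fun x y => (4^-1 : R) *: (C x y - C (J x) (J y) - B (J x) y - B x (J y))).
Proof.
move=> bB bC; apply/funext => X; rewrite /component fct_sumE big_mkcond sum_set_ord2.
rewrite cards0 !cards1 cardsT card_ord /= !add0r type_part_cform2 // !inE /type_sign /cform2.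
by congr pair; apply: smoothFunP => p; rewrite !smoothFunE; ring.
Qed.

(** The two singletons [S] contribute the mixed terms in (J x, y) and (x, J y) with opposite signs;
    what remains is the J-invariant part. *)
Lemma component_cform2_1 B C : Cbilinear B -> Cbilinear C ->
  component J 1 (cform2 B C) =
    cform2 (fun x y => (2^-1 : R) *: (B x y + B (J x) (J y)))
        (fun x y => (2^-1 : R) *: (C x y + C (J x) (J y))).
Proof.
move=> bB bC; apply/funext => X; rewrite /component fct_sumE big_mkcond sum_set_ord2.
rewrite cards0 !cards1 cardsT card_ord /= add0r addr0 !type_part_cform2 //.
rewrite !inE /type_sign /cform2.
by rewrite pairD /=; congr pair; apply: smoothFunP => p; rewrite !smoothFunE; field.
Qed.

Lemma is_form_cform1 a b : Clinear a -> Clinear b -> is_form (cform1 a b).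
Proof.
move=> la lb; split=> [X i f Y Z|X i j]; last by rewrite !ord1.
by rewrite /cform1 /set_arg !ord1 /= la lb pairZ pairD.
Qed.

Lemma skew_diag B : (forall x y, B y x = - B x y) -> forall x, B x x = 0.
Proof.
move=> sB x; apply: smoothFunP => p; have := congr1 (fun f : A => f p) (sB x x).
by rewrite !smoothFunE => E; lra.
Qed.

Lemma is_form_cform2 B C : Cbilinear B -> Cbilinear C ->
  (forall x y, B y x = - B x y) -> (forall x y, C y x = - C x y) -> is_form (cform2 B C).
Proof.
move=> bB bC sB sC; split=> [X i f Y Z|X i j].
  by have [->|->] := ord2P i; rewrite /cform2 /set_arg /= ?(Cbilinearl bB) ?(Cbilinearl bC)
    ?(Cbilinearr bB) ?(Cbilinearr bC) pairZ pairD.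
have [->|->] := ord2P i; have [->|->] := ord2P j => //= _ E.
- by rewrite /cform2 E !skew_diag.
- by rewrite /cform2 E !skew_diag.
Qed.

Lemma bidegree_form10 a : Clinear a -> bidegree J 1 0 (form10_of J a).
Proof.
move=> la; have lb : Clinear (fun w => - a (J w)).
  by move=> f x y; rewrite linearP la opprD mulrN.
rewrite (_ : form10_of J a = cform1 a (fun w => - a (J w))) //; split=> //.
  exact: is_form_cform1.
move=> S S1; apply/funext => X; rewrite type_part_cform1 //.
have S0 : (ord0 \in S) = false.
  apply: contraNF S1 => S0; apply/cards1P; exists ord0; apply/finset.setP => i.
  by rewrite inE ord1 S0 eqxx.
rewrite S0 /type_sign JJ -[RHS]/((0, 0) : smoothFunC M).
by congr pair; apply: smoothFunP => p; rewrite ?(ClinearN la) !smoothFunE; ring.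
Qed.

(** The last two hypotheses express, for alpha = B + i C, that alpha(J x, y) = i alpha(x, y). *)
Lemma bidegree_cform2_20 B C : Cbilinear B -> Cbilinear C ->
  (forall x y, B y x = - B x y) -> (forall x y, C y x = - C x y) ->
  (forall x y, B (J x) y = - C x y) -> (forall x y, C (J x) y = B x y) ->
  bidegree J 2 0 (cform2 B C).
Proof.
move=> bB bC sB sC BJ CJ; split=> //; first exact: is_form_cform2.
move=> S S2; apply/funext => X; rewrite type_part_cform2 // -[RHS]/((0, 0) : smoothFunC M).
have BJr x y : B x (J y) = - C x y by rewrite sB BJ opprK sC.
have CJr x y : C x (J y) = B x y by rewrite sC CJ sB opprK.
have := S2; case: (set_ord2P S) => ->; rewrite ?cards0 ?cards1 ?cardsT ?card_ord //= => _;
  rewrite !inE /type_sign /= !BJ !CJ !BJr !CJr;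
  by congr pair; apply: smoothFunP => p; rewrite !smoothFunE; ring.
Qed.

Lemma bidegree_cform2_11 B C : Cbilinear B -> Cbilinear C ->
  (forall x y, B y x = - B x y) -> (forall x y, C y x = - C x y) ->
  (forall x y, B (J x) (J y) = B x y) -> (forall x y, C (J x) (J y) = C x y) ->
  bidegree J 1 1 (cform2 B C).
Proof.
move=> bB bC sB sC BJ CJ; split=> //; first exact: is_form_cform2.
move=> S S2; apply/funext => X; rewrite type_part_cform2 // -[RHS]/((0, 0) : smoothFunC M).
have BJr x y : B x (J y) = - B (J x) y by rewrite -[LHS]BJ JJ (CbilinearNr bB).
have CJr x y : C x (J y) = - C (J x) y by rewrite -[LHS]CJ JJ (CbilinearNr bC).
have := S2; case: (set_ord2P S) => ->; rewrite ?cards0 ?cards1 ?cardsT ?card_ord //= => _;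
  rewrite !inE /type_sign /= !BJ !CJ !BJr !CJr;
  by congr pair; apply: smoothFunP => p; rewrite !smoothFunE; ring.
Qed.

(** A nontrivial del-delbar image has q > 0, so only the zero constructor can apply. *)
Lemma deldelbar_exact20 (zeta : cform M 2) :
  deldelbar_exact J 2 0 zeta -> zeta = 0.
Proof.
suff H p q k (z : cform M k) : deldelbar_exact J p q z -> q = 0%N -> z = 0.
  by move=> /H; apply.
by case.
Qed.

(** The degree is itself an index of the predicate, so inversion is done for a variable degree,
    transported along an equality with 2; [bidegree] forces the potential to have degree 0, and
    uniqueness of equality proofs in nat removes the transport. *)
Lemma deldelbar_exact11 (rho : cform M 2) : deldelbar_exact J 1 1 rho ->
  rho = 0 \/ exists lambda : cform M 0, rho = del J 0 (delbar J 0 lambda).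
Proof.
suff H p q k (z : cform M k) : deldelbar_exact J p q z ->
    forall e : k = 2%N, p = 1%N -> q = 1%N ->
    ecast k (cform M k) e z = 0 \/
    exists lambda : cform M 0, ecast k (cform M k) e z = del J 0 (delbar J 0 lambda).
  by move=> /H/(_ erefl erefl erefl).
case=> [p' q' k'|p' q' k' lambda bl] e.
  by move=> _ _; left; case: _ / e.
move=> [p0] [q0]; right; move: (bl) => [kE _ _].
rewrite p0 q0 in kE *; subst k'.
by exists lambda; rewrite eq_axiomK.
Qed.

Lemma lie_bracket_linear (f : A) (X Y Z : V) :
  lie_bracket (f *: X + Y) Z = f *: lie_bracket X Z + lie_bracket Y Z - (Z f : A) *: X.
Proof.
apply: vectorFieldP => k p.
rewrite -[LHS]/((f * (X (Z k) : A) + (Y (Z k) : A) -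
  (Z (f * (X k : A) + (Y k : A)) : A)) p).
rewrite vfD vfM -[RHS]/((f * ((X (Z k) : A) - (Z (X k) : A)) +
  ((Y (Z k) : A) - (Z (Y k) : A)) - (Z f : A) * (X k : A)) p).
by rewrite !smoothFunE; ring.
Qed.

Lemma lie_bracketC (X Y : V) : lie_bracket Y X = - lie_bracket X Y.
Proof.
apply: vectorFieldP => k p.
rewrite -[LHS]/(((Y (X k) : A) - (X (Y k) : A)) p).
by rewrite -[RHS]/((- ((X (Y k) : A) - (Y (X k) : A))) p) opprB.
Qed.

Lemma dform1_skew a : Clinear a -> forall x y, dform1 a y x = - dform1 a x y.
Proof.
move=> la x y; rewrite /dform1 lie_bracketC (ClinearN la); apply: smoothFunP => p.
by rewrite !smoothFunE; ring.
Qed.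

Lemma Cbilinear_dform1 a : Clinear a -> Cbilinear (dform1 a).
Proof.
move=> la.
have L f x y z : dform1 a (f *: x + y) z = f * dform1 a x z + dform1 a y z.
  rewrite /dform1 lie_bracket_linear (ClinearB la) !la (ClinearZ la) vfD vfM.
  rewrite -[X in X - _ - _]/(f * (x (a z) : A) + (y (a z) : A)).
  by apply: smoothFunP => p; rewrite !smoothFunE; ring.
split=> // f x y z.
rewrite dform1_skew // L opprD -mulrN -!dform1_skew //.
Qed.

Lemma Clinear_vf (f : A) : Clinear (fun x : V => x f : A).
Proof. by []. Qed.

Lemma Clinear_vfJ (f : A) : Clinear (fun x : V => J x f : A).
Proof. by move=> k x y; rewrite linearP. Qed.

Lemma dform1_vf (f : A) x y : dform1 (fun w : V => w f : A) x y = 0.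
Proof. by rewrite /dform1 -[lie_bracket x y f]/((x (y f) : A) - (y (x f) : A)) subrr. Qed.

Lemma dform1B a b x y : dform1 (fun w => a w - b w) x y = dform1 a x y - dform1 b x y.
Proof.
by rewrite /dform1 !vfD !vfN; apply: smoothFunP => p; rewrite !smoothFunE; ring.
Qed.

Lemma dform1D a b x y : dform1 (fun w => a w + b w) x y = dform1 a x y + dform1 b x y.
Proof.
by rewrite /dform1 !vfD; apply: smoothFunP => p; rewrite !smoothFunE; ring.
Qed.

Lemma dform1Z (r : R) a x y : dform1 (fun w => r *: a w) x y = r *: dform1 a x y.
Proof.
by rewrite /dform1 !vfZ; apply: smoothFunP => p; rewrite !smoothFunE; ring.
Qed.

Lemma ClinearZr (r : R) a : Clinear a -> Clinear (fun w => r *: a w).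
Proof.
move=> la f x y; rewrite la.
by apply: smoothFunP => p; rewrite !smoothFunE; ring.
Qed.

Lemma Clinear_add a b : Clinear a -> Clinear b -> Clinear (fun w => a w + b w).
Proof.
move=> la lb f x y; rewrite la lb.
by apply: smoothFunP => p; rewrite !smoothFunE; ring.
Qed.

Lemma Clinear_sub a b : Clinear a -> Clinear b -> Clinear (fun w => a w - b w).
Proof.
move=> la lb f x y; rewrite la lb.
by apply: smoothFunP => p; rewrite !smoothFunE; ring.
Qed.

Lemma dform0 (lambda : cform M 0) : exists a b : A,
  dform lambda = cform1 (fun x => x a) (fun x => x b).
Proof.
exists (lambda (fun=> 0)).1, (lambda (fun=> 0)).2; apply/funext => X.
rewrite /dform big_ord1 big_mkcond big_ord0 subr0 expr0 scale1r.
by rewrite /vf_actC (_ : X \o lift ord0 = fun=> 0) //; apply/funext => -[].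
Qed.

(** Since d(da) = d(db) = 0, only the forms d(db J) and d(da J) survive, separated into the real and
    the imaginary part. The constant 1/4 combines one factor 1/2 from each projection to a type. *)
Lemma deldelbar_cform2 (lambda : cform M 0) : exists a b : A,
  del J 0 (delbar J 0 lambda) =
    cform2 (fun x y => (- 4^-1 : R) *: (dform1 (fun w => J w b : A) x y +
                                     dform1 (fun w => J w b : A) (J x) (J y)))
        (fun x y => (4^-1 : R) *: (dform1 (fun w => J w a : A) x y +
                                   dform1 (fun w => J w a : A) (J x) (J y))).
Proof.
have [a [b E]] := dform0 lambda; exists a, b.
have la := Clinear_vf a; have lb := Clinear_vf b.
have lJa := Clinear_vfJ a; have lJb := Clinear_vfJ b.
rewrite /delbar E component_cform1 // /del dform_cform1 component_cform2_1; first last.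
- exact/Cbilinear_dform1/ClinearZr/Clinear_add.
- exact/Cbilinear_dform1/ClinearZr/Clinear_sub.
apply/funext => X; rewrite /cform2 !dform1Z !dform1B !dform1D !dform1_vf.
by congr pair; apply: smoothFunP => p; rewrite !smoothFunE; field.
Qed.

End Bidegrees.

(** * Parallel 2-forms *)

Section ParallelForms.
Context {R : realType} (M : manifold R).
Local Notation A := 'C^oo(M).
Local Notation V := (vectorField M).
Variable nabla : V -> V -> V.
Hypothesis torsion_free : forall X Y : V, nabla X Y - nabla Y X = lie_bracket X Y.
Implicit Types (a : V -> A) (B C : V -> V -> A).

Definition parallel B := forall x y z : V, x (B y z) = B (nabla x y) z + B y (nabla x z).

Lemma vf_add_act (X Y : V) (f : A) : ((X + Y) f : A) = (X f : A) + (Y f : A).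
Proof. by []. Qed.

Lemma vf_opp_act (X : V) (f : A) : ((- X) f : A) = - (X f : A).
Proof. by []. Qed.

(** For a torsion-free connection the exterior derivative is the alternating sum of covariant
    derivatives. *)
Lemma dform2_parallel B : Cbilinear B -> (forall x y, B y x = - B x y) -> parallel B ->
  forall x y z, dform2 B x y z = 0.
Proof.
move=> bB sB pB x y z; rewrite /dform2 !pB -!torsion_free.
rewrite !(CbilinearBl bB) !(CbilinearBr bB) [B y (nabla z x)]sB.
by apply: smoothFunP => p; rewrite !smoothFunE; ring.
Qed.

Lemma lie_bracket_jacobi (x y z : V) :
  lie_bracket (lie_bracket x y) z + lie_bracket y (lie_bracket x z) =
  lie_bracket x (lie_bracket y z).
Proof.
apply: vectorFieldP => f p; rewrite vf_add_act.
have E (X Y : V) (k : A) : (lie_bracket X Y k : A) = (X (Y k) : A) - (Y (X k) : A) by [].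
by rewrite !E !vfD !vfN !smoothFunE; ring.
Qed.

Lemma dform2_dform1 a : Clinear a -> forall x y z, dform2 (dform1 a) x y z = 0.
Proof.
move=> la x y z; rewrite /dform2 /dform1 -(lie_bracket_jacobi x y z) (ClinearD la).
have E (X Y : V) (k : A) : (lie_bracket X Y k : A) = (X (Y k) : A) - (Y (X k) : A) by [].
rewrite !E !vfD !vfN.
by apply: smoothFunP => p; rewrite !smoothFunE; ring.
Qed.

Lemma dform1_parallel B (v : V) : Cbilinear B -> parallel B ->
  forall x y, dform1 (B v) x y = B (nabla x v) y - B (nabla y v) x.
Proof.
move=> bB pB x y; rewrite /dform1 !pB -torsion_free (CbilinearBr bB).
by apply: smoothFunP => p; rewrite !smoothFunE; ring.
Qed.

(* By Cartan's formula [d (B v)] is the Lie derivative of the closed form [B],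
   which is parallel as [v] preserves [nabla]. *)
Lemma parallel_dform1_affine B (v : V) : Cbilinear B -> (forall x y, B y x = - B x y) ->
  parallel B -> affine nabla v -> parallel (dform1 (B v)).
Proof.
move=> bB sB pB av.
have L x y : dform1 (B v) x y =
    (v (B x y) : A) - B (lie_bracket v x) y - B x (lie_bracket v y).
  rewrite dform1_parallel // pB -!torsion_free (CbilinearBl bB) (CbilinearBr bB).
  rewrite [B x (nabla y v)]sB.
  by apply: smoothFunP => p; rewrite !smoothFunE; ring.
have aE x y : lie_bracket v (nabla x y) =
    nabla (lie_bracket v x) y + nabla x (lie_bracket v y).
  by apply/eqP; rewrite -subr_eq0 opprD addrA; apply/eqP/av.
have comm (z : V) (f : A) : (z (v f) : A) = (v (z f) : A) - (lie_bracket v z f : A).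
  by rewrite -[lie_bracket v z f]/((v (z f) : A) - (z (v f) : A)) opprB addrC subrK.
move=> z x y; rewrite !L !aE !(CbilinearDl bB) !(CbilinearDr bB) !vfD !vfN comm.
rewrite [z (B x y)]pB [lie_bracket v z (B x y)]pB vfD.
rewrite [z (B (lie_bracket v x) y)]pB [z (B x (lie_bracket v y))]pB.
by apply: smoothFunP => p; rewrite !smoothFunE; ring.
Qed.

End ParallelForms.

Section RealAndImaginaryParts.
Context {R : realType} (M : manifold R).
Local Notation A := 'C^oo(M).
Local Notation V := (vectorField M).

Lemma cform2_inj (B C B' C' : V -> V -> A) : cform2 B C = cform2 B' C' ->
  forall x y, B x y = B' x y /\ C x y = C' x y.
Proof.
move=> E x y.
have := congr1 (fun al : cform M 2 => al (fun i => if i == ord0 then x else y)) E.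
by rewrite /cform2 /= => -[].
Qed.

Lemma cform2_eq0 (B C : V -> V -> A) : cform2 B C = 0 -> forall x y, B x y = 0 /\ C x y = 0.
Proof. exact: (@cform2_inj B C (fun _ _ => 0) (fun _ _ => 0)). Qed.

Lemma linear_of_Clinear (a : V -> A^o) : Clinear a -> exists xi : {linear V -> A^o}, xi =1 a.
Proof.
move=> la; have lin : GRing.linear_for *:%R a by exact: la.
pose xi : {linear V -> A^o} := HB.pack a (GRing.isLinear.Build _ _ _ _ a lin).
by exists xi.
Qed.

End RealAndImaginaryParts.

(** * From the del-delbar property to the potential and the holomorphic form *)

Theorem theorem6p1 (R : realType) (M : manifold R)
    (g : vectorField M -> vectorField M -> 'C^oo(M))
    (J : {linear vectorField M -> vectorField M})
    (nabla : vectorField M -> vectorField M -> vectorField M)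
    (v : vectorField M)
    (compactM : compact [set: M]) (connectedM : connected [set: M])
    (kaehler : pseudo_kaehler g J nabla)
    (deldelbar : deldelbar_property J)
    (affine_v : affine nabla v) :
  exists (phi : 'C^oo(M)) (xi : {linear vectorField M -> 'C^oo(M)^o}),
    holomorphic_1form J (form10_of J xi) /\
    forall w : vectorField M, g v w = (J w) phi + xi w.
Proof.
case: kaehler => -[gs gl _] [_ torsion_free gm] JJ gJ nablaJ.
have bg : Cbilinear g.
  by split=> f x y z; rewrite ?gl // gs gl gs [g z y]gs.
have pg : parallel nabla g by exact: gm.
pose om x y := g x (J y).
have bom : Cbilinear om.
  by split=> f x y z; rewrite /om ?(Cbilinearl bg) // linearP (Cbilinearr bg).
have som x y : om y x = - om x y.
  by rewrite /om -gJ JJ (CbilinearNr bg) gs.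
have pom : parallel nabla om by move=> x y z; rewrite /om pg nablaJ.
have lal : Clinear (om v) by move=> f x y; exact: (Cbilinearr bom).
have lgv : Clinear (g v) by move=> f x y; exact: (Cbilinearr bg).
pose beta := dform1 (om v); pose N := dform1 (g v).
have bbeta : Cbilinear beta by exact: Cbilinear_dform1.
have sbeta x y : beta y x = - beta x y by exact: dform1_skew.
have bN : Cbilinear N by exact: Cbilinear_dform1.
have sN x y : N y x = - N x y by exact: dform1_skew.
have pbeta : parallel nabla beta by exact: parallel_dform1_affine.
have betaE x y : beta x y = om (nabla x v) y - om (nabla y v) x.
  exact: dform1_parallel.
have NE x y : N x y = g (nabla x v) y - g (nabla y v) x.
  exact: (dform1_parallel torsion_free v bg pg).
(* Because J J = -1, the form - (om v) J is g(v, .), so the two parts of the derivative are [beta]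
   and [N]. *)
have dform10 : dform (form10_of J (om v)) = cform2 beta N.
  rewrite -dform_cform1; congr dform; apply/funext => X.
  by rewrite /form10_of /cform1 /om JJ (CbilinearNr bg) opprK.
have bid10 : bidegree J 1 0 (form10_of J (om v)) by exact: bidegree_form10.
have bilinJJ B : Cbilinear B -> Cbilinear (fun x y => B (J x) (J y)).
  by move=> bB; split=> f x y z; rewrite linearP ?(Cbilinearl bB) ?(Cbilinearr bB).
pose Br x y := (2^-1 : R) *: (beta x y - beta (J x) (J y)).
pose Bi x y := (2^-1 : R) *: (- (beta (J x) y + beta x (J y))).
have bBr : Cbilinear Br.
  by split=> f x y z; rewrite /Br linearP ?(Cbilinearl bbeta) ?(Cbilinearr bbeta);
    apply: smoothFunP => p; rewrite !smoothFunE; ring.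
have bBi : Cbilinear Bi.
  by split=> f x y z; rewrite /Bi linearP ?(Cbilinearl bbeta) ?(Cbilinearr bbeta);
    apply: smoothFunP => p; rewrite !smoothFunE; ring.
have sBr x y : Br y x = - Br x y.
  rewrite /Br [beta y x]sbeta [beta (J y) _]sbeta.
  by apply: smoothFunP => p; rewrite !smoothFunE; ring.
have sBi x y : Bi y x = - Bi x y.
  rewrite /Bi [beta y _]sbeta [beta (J y) _]sbeta.
  by apply: smoothFunP => p; rewrite !smoothFunE; ring.
have pBr : parallel nabla Br.
  move=> x y z; rewrite /Br vfZ vfD vfN !pbeta !nablaJ.
  by apply: smoothFunP => p; rewrite !smoothFunE; ring.
have pBi : parallel nabla Bi.
  move=> x y z; rewrite /Bi vfZ vfN vfD !pbeta !nablaJ.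
  by apply: smoothFunP => p; rewrite !smoothFunE; ring.
(* The formulas [betaE] and [NE] in terms of the covariant derivative of [v] yield N(J x, y) + N(x,
   J y) = beta(x, y) - beta(J x, J y) and its counterpart for the imaginary part, which eliminates
   [N]. *)
have zetaE : del J 1 (form10_of J (om v)) = cform2 Br Bi.
  rewrite /del dform10 component_cform2_2 //.
  have omJ x y : om (x) (J y) = - g x y by rewrite /om JJ (CbilinearNr bg).
  apply/funext => X; rewrite /cform2 /Br /Bi !betaE !NE !omJ /om.
  by congr pair; apply: smoothFunP => p; rewrite !smoothFunE; field.
(* [Br + i Bi] is twice the (2,0) part of [beta]: parallel, hence closed. *)
have zeta0 : cform2 Br Bi = 0.
  apply: deldelbar_exact20 (deldelbar 2 0 2 _ _ _ _).
  - apply: bidegree_cform2_20 => // x y; rewrite /Br /Bi JJ (CbilinearNl bbeta).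
      by apply: smoothFunP => p; rewrite !smoothFunE; ring.
    by apply: smoothFunP => p; rewrite !smoothFunE; ring.
  - by apply: dform_cform2; apply: dform2_parallel.
  - by left; rewrite -zetaE; exact: del_exactS.
have betaJ x y : beta (J x) (J y) = beta x y.
  have [+ _] := cform2_eq0 zeta0 x y; rewrite /Br => E; apply: smoothFunP => p.
  by have := congr1 (fun f : 'C^oo(M) => f p) E; rewrite !smoothFunE; lra.
have betaJr x y : beta x (J y) = - beta (J x) y.
  by rewrite -[LHS]betaJ JJ (CbilinearNr bbeta).
(* The imaginary part of the vanishing (2,0) component: its two [beta] terms cancel by [betaJr],
   leaving the invariance of [N]. *)
have NJ x y : N (J x) (J y) = N x y.
  have := zetaE; rewrite /del dform10 component_cform2_2 // zeta0.
  move=> /cform2_eq0/(_ x y)[_]; rewrite betaJr => E; apply: smoothFunP => p.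
  by have := congr1 (fun f : 'C^oo(M) => f p) E; rewrite !smoothFunE; lra.
have rhoE : delbar J 1 (form10_of J (om v)) = cform2 beta N.
  rewrite /delbar dform10 component_cform2_1 //; apply/funext => X.
  rewrite /cform2 betaJ NJ.
  by congr pair; apply: smoothFunP => p; rewrite !smoothFunE; field.
have rho_exact : deldelbar_exact J 1 1 (cform2 beta N).
  apply: deldelbar.
  - exact: bidegree_cform2_11.
  - by apply: dform_cform2; exact: dform2_dform1.
  - by right; rewrite -rhoE; exact: delbar_exactS.
pose D (f : 'C^oo(M)) x y := dform1 (fun w => J w f : 'C^oo(M)) x y.
have [a [b abE]] : exists a b : 'C^oo(M), forall x y,
    beta x y = (- 4^-1 : R) *: (D b x y + D b (J x) (J y)) /\
    N x y = (4^-1 : R) *: (D a x y + D a (J x) (J y)).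
  have [E|[lambda E]] := deldelbar_exact11 rho_exact; last first.
    have [a [b abE]] := deldelbar_cform2 J lambda; exists a, b => x y.
    by rewrite abE in E; exact: cform2_inj E x y.
  (* Exactness may also hold through the zero constructor, which supplies no potential; then [beta]
     and [N] vanish and zero functions serve. *)
  have D0 x y : D 0 x y = 0.
    by rewrite /D /dform1 !vf0 !subr0.
  exists 0, 0 => x y; have [-> ->] := cform2_eq0 E x y.
  by rewrite !D0 addr0 !scaler0.
(* [beta] is parallel and [z, w |-> beta z (J w)] is the J-invariant part of the
   Hessian of [b], up to terms that vanish at the critical points of [b]. *)
have beta0 x y : beta x y = 0.
  suff H z w : beta z (J w) = 0.
    by rewrite -[y]opprK -JJ H.
  apply: (@parallel_hessian_eq0 R M nabla (fun z w => beta z (J w)) b) => //.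
  - split=> [f X Y Z|X Y|X Y Z].
    + by rewrite (Cbilinearl bbeta).
    + by rewrite betaJr sbeta opprK.
    + by rewrite pbeta nablaJ.
  (* With J J = -1, d(db J)(X, J X) is minus the sum of X X b, (J X)(J X) b and (J [X, J X]) b: two
     second derivatives and a first-order term. *)
  - move=> X; exists X, (J X), (J (lie_bracket X (J X))).
    have [-> _] := abE X (J X).
    rewrite [D b (J X) _](_ : _ = D b X (J X)); last first.
      have bD : Cbilinear (D b) by apply: Cbilinear_dform1; exact: Clinear_vfJ.
      by rewrite JJ (CbilinearNr bD) /D dform1_skew ?opprK //; exact: Clinear_vfJ.
    rewrite /D /dform1 JJ vf_opp_act vfN.
    by apply: smoothFunP => p; rewrite !smoothFunE; field.
(* [N] is half the (1,1) part of d(da J), that is, the (1,1) part of d(dphi J) for this [phi]. *)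
pose phi : 'C^oo(M) := (2^-1 : R) *: a.
have lxi : Clinear (fun w => g v w - (J w phi : 'C^oo(M))).
  by apply: Clinear_sub => //; exact: Clinear_vfJ.
have [xi xiE] := @linear_of_Clinear R M _ lxi.
have lxi' : Clinear xi by move=> f x y; rewrite linearP.
exists phi, xi; split; last first.
  by move=> w; rewrite xiE addrC subrK.
split; first exact: bidegree_form10.
have form10E : form10_of J xi = cform1 xi (fun w => - xi (J w)) by [].
have lxiJ : Clinear (fun w => - xi (J w)).
  by move=> f x y; rewrite linearP lxi' opprD mulrN.
rewrite /delbar form10E dform_cform1 component_cform2_1; try exact: Cbilinear_dform1.
have dform1xi x y : dform1 xi x y = N x y - (2^-1 : R) *: D a x y.
  have -> : (xi : _ -> _) = (fun w => g v w - (J w phi : 'C^oo(M))) by apply/funext.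
  rewrite dform1B -/N; congr (_ - _); rewrite /D -dform1Z; congr dform1.
  by apply/funext => w; rewrite /phi vfZ.
(* Composition with J turns g(v, .) into [om v] and (dphi) J into - dphi, so the derivative reduces
   to - [beta]. *)
have dform1xiJ x y : dform1 (fun w => - xi (J w)) x y = 0.
  have -> : (fun w => - xi (J w)) = (fun w => (-1 : R) *: (om v w + (w phi : 'C^oo(M)))).
    by apply/funext => w; rewrite xiE JJ vf_opp_act opprK scaleN1r.
  by rewrite dform1Z dform1D dform1_vf -/beta beta0 addr0 scaler0.
apply/funext => X; rewrite /cform2 !dform1xi !dform1xiJ -[RHS]/((0, 0) : smoothFunC M).
congr pair; last by rewrite addr0 scaler0.
rewrite NJ; have [_ ->] := abE (X ord0) (X ord_max).
by apply: smoothFunP => p; rewrite !smoothFunE; field.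
Qed.
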